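(* The $\mathbb C$-valued bilinear functions $\bar\phi_1,\bar\phi_2$ on $\mathrm{Der}(R)\times\mathrm{Der}(R)$, $\bar\phi_i(x,y)=\phi_i(\Phi_f(x),\Phi_f(y))$, are 2-cocycles that are not 2-coboundaries. On the basis elements $e_k=t^kD$, $d_k=t^kuD$ ($k\in\mathbb Z$) of $\mathrm{Der}(R)$ they have the following values. For all $k,l\in\mathbb Z$: \begin{align*} \bar\phi_1(e_k,e_l)&=2(l^2-l)(2l-1)\,\delta_{k+l,1}+(l^3-l)\,\delta_{k+l,0},\\ \bar\phi_1(e_k,d_l)&=6(-1)^{k+l}2^{k+l}(k-1)kl\,\frac{(2k+2l-3)!!}{(k+l+1)!},\\ \bar\phi_1(d_l,e_k)&=-\bar\phi_1(e_k,d_l),\\ \bar\phi_1(d_k,d_l)&=l(l+1)(l+2)\,\delta_{k+l,-2}+4l(2l+1)(l+1)\,\delta_{k+l,-1}+4l(2l-1)(2l+1)\,\delta_{k+l,0}. \end{align*} For all $k,l\in\mathbb Z$: \begin{align*} \bar\phi_2(e_k,e_l)&=-2(l^3-l)\,\delta_{k+l,0}-4l(l-1)(2l-1)\,\delta_{k+l,1},\\ \bar\phi_2(e_k,d_l)&=-\bar\phi_2(d_l,e_k)=0,\\ \bar\phi_2(d_k,d_l)&=-2l(l+1)(l+2)\,\delta_{k+l,-2}-8l(l+1)(2l+1)\,\delta_{k+l,-1}-8l(2l-1)(2l+1)\,\delta_{k+l,0}. \end{align*} In particular $\bar\phi_2(d_k,d_l)=-2\bar\phi_1(d_k,d_l)$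 and $\bar\phi_2(e_k,e_l)=-2\bar\phi_1(e_k,e_l)$ for all $k,l\in\mathbb Z$.
   Context: All vector spaces and algebras are over $\mathbb C$; $\mathrm{Der}(A)$ denotes the Lie algebra of derivations of a ring ($\mathbb C$-algebra) $A$; $\delta_{i,j}$ is the Kronecker delta. 2-cocycles: for a Lie algebra $\mathfrak l$, a 2-cocycle is a bilinear function $\varphi:\mathfrak l\times\mathfrak l\to\mathbb C$ with $\varphi(x,y)=-\varphi(y,x)$ and $\varphi([x,y],z)+\varphi([y,z],x)+\varphi([z,x],y)=0$ for all $x,y,z\in\mathfrak l$. It is a 2-coboundary if there is a linear map $h:\mathfrak l\to\mathbb C$ with $\varphi(x,y)=h([x,y])$ for all $x,y$. Rings and derivations: $R=\mathbb C[t,t^{-1},u\mid u^2=t^2+4t]$, i.e. $R=\mathbb C[t,t^{-1},u]/(u^2-(t^2+4t))$, and $S=\mathbb C[s,s^{-1},(s-1)^{-1}]$, with $\partial=\partial_s=\frac{d}{ds}$. $D\in\mathrm{Der}(R)$ is the derivation induced by $(t+2)\frac{\partial}{\partial u}+u\frac{\partial}{\partial t}$, so $D(t)=u$ and $D(u)=t+2$. One has $\mathrm{Der}(R)=R\,D$, with basis $e_n=t^nD$, $d_n=t^nuD$ ($n\in\mathbb Z$). The isomorphism: $f:R\to S$, $f(t)=s^{-1}(s-1)^2$, $f(u)=s-s^{-1}$, is a ring isomorphism, with inverse given by $s\mapsto\frac{t+2+u}{2}$, $s^{-1}\mapsto\frac{t+2-u}{2}$. The Lie algebra isomorphism $\Phi_f:\mathrm{Der}(R)\to\mathrm{Der}(S)$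 is $\Phi_f(\delta)=f\circ\delta\circ f^{-1}$. The functions $\phi_1,\phi_2$: $\mathrm{Der}(S)=S\,\partial$ has basis $\{s^k\partial : k\in\mathbb Z\}\cup\{(s-1)^{-l}\partial : l\in\mathbb N,\ l\ge 1\}$. The functions $\phi_1,\phi_2:\mathrm{Der}(S)\times\mathrm{Der}(S)\to\mathbb C$ are the skew-symmetric bilinear functions with the following values on pairs of basis elements (and value $0$ on all pairs of basis elements not determined by these and skew-symmetry): - $\phi_1(s^{k+1}\partial,s^{-l+1}\partial)=\delta_{k,l}(l^3-l)$ for $k,l\in\mathbb Z$, and $\phi_1(s^{-k}\partial,(s-1)^{-l}\partial)=(-1)^{l+1}\frac{(k+l+1)!}{(k-1)!\,(l-1)!}$ for integers $k,l\ge 1$. - $\phi_2(s^{k+1}\partial,(s-1)^{-l+1}\partial)=\binom{k+1}{l+1}(l^3-l)$ for nonnegative integers $k,l$, and $\phi_2((s-1)^{-k}\partial,s^{-l}\partial)=(-1)^{k+1}\frac{(k+l+1)!}{(k-1)!\,(l-1)!}$ for integers $k,l\ge 1$. Conventions for double factorials and factorials: for a positive odd integer $m$, $m!!=m(m-2)\cdots5\cdot3\cdot1$; this is extended to all odd integers by $(-1)!!=1$ and the recursion $m!!=m\,(m-2)!!$, so that for instance $(-3)!!=-1$ and $(-5)!!=\frac13$. For a negative integer $n$, $\frac1{n!}$ is interpreted as $0$. *)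

(* Defs.v *)
From HB Require Import structures.
From mathcomp Require Import all_boot all_order all_algebra.
From mathcomp Require Import generic_quotient ring_quotient sesquilinear.
From mathcomp Require Import boolp classical_sets functions.
From mathcomp Require Import mpoly.
From mathcomp Require Import ring zify.

Set Implicit Arguments.
Unset Strict Implicit.
Unset Printing Implicit Defensive.

Import GRing.Theory Num.Theory.
Local Open Scope ring_scope.
Local Open Scope quotient_scope.

(** * Lie algebras and their 2-cocycles *)

HB.mixin Record Lmodule_isLieAlgebra (K : comNzRingType) L
    of GRing.Lmodule K L := {
  bracket : L -> L -> L;
  bracketDZl : forall (c : K) (x y z : L),
    bracket (c *: x + y) z = c *: bracket x z + bracket y z;
  bracketxx : forall x : L, bracket x x = 0;
  bracketJ : forall x y z : L,
    bracket (bracket x y) z + bracket (bracket y z) x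
      + bracket (bracket z x) y = 0 }.

#[short(type="liealgType")]
HB.structure Definition LieAlgebra (K : comNzRingType) :=
  {L of GRing.Lmodule K L & Lmodule_isLieAlgebra K L}.

Section Cocycles.
Context {K : comNzRingType} {L : liealgType K}.

Definition two_cocycle (phi : L -> L -> K) : Prop :=
  [/\ bilinear_for *%R *%R phi,
      forall x y, phi x y = - phi y x
    & forall x y z, phi (bracket x y) z + phi (bracket y z) x
                      + phi (bracket z x) y = 0].

Definition two_coboundary (phi : L -> L -> K) : Prop :=
  exists h : {scalar L}, forall x y, phi x y = h (bracket x y).

End Cocycles.

(** * Derivations *)

Section Derivations.
Context {K : comNzRingType}.
Variable A : comAlgType K.
Implicit Types (d : A -> A).

Definition is_derivation d : Prop :=
  linear d /\ forall x y, d (x * y) = d x * y + x * d y.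

Definition derivation : {pred A -> A} := fun d => `[< is_derivation d >].

Lemma derivationP d : reflect (is_derivation d) (d \in derivation).
Proof. exact: asboolP. Qed.

Lemma derivation_submod : submod_closed derivation.
Proof.
split=> [|c d1 d2 /derivationP[l1 m1] /derivationP[l2 m2]].
- apply/derivationP; split=> [c x y|x y].
  + by rewrite /GRing.zero /= scaler0 addr0.
  + by rewrite /GRing.zero /= mul0r mulr0 addr0.
apply/derivationP; split=> [a x y|x y]; rewrite !fctE.
- rewrite l1 l2 !scalerDr !scalerA [a * c]mulrC !addrA; congr (_ + _).
  by rewrite -!addrA; congr (_ + _); rewrite addrC.
- rewrite m1 m2 scalerDr mulrDl mulrDr -!scalerAl -!scalerAr !addrA.
  by congr (_ + _); rewrite -!addrA; congr (_ + _); rewrite addrC.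
Qed.

HB.instance Definition _ :=
  GRing.isSubmodClosed.Build K (A -> A) derivation derivation_submod.

Record Der := MkDer { der_fun :> A -> A; _ : der_fun \in derivation }.

HB.instance Definition _ := [isSub for der_fun].
HB.instance Definition _ := [Choice of Der by <:].
HB.instance Definition _ := [SubChoice_isSubLmodule of Der by <:].

Implicit Types D : Der.

Lemma derP D : is_derivation D.
Proof. by apply/derivationP; case: D. Qed.

Lemma der_eq D1 D2 : (forall x, D1 x = D2 x) -> D1 = D2.
Proof. by move=> e; apply/val_inj/funext. Qed.

Lemma derM D x y : D (x * y) = D x * y + x * D y.
Proof. by case: (derP D). Qed.

Lemma derDZ D c x y : D (c *: x + y) = c *: D x + D y.
Proof. by case: (derP D) => + _; apply. Qed.

Lemma derD D x y : D (x + y) = D x + D y.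
Proof. by have := derDZ D 1 x y; rewrite !scale1r. Qed.

Lemma der0 D : D 0 = 0.
Proof. by apply: (@addrI _ (D 0)); rewrite -derD !addr0. Qed.

Lemma derZ D c x : D (c *: x) = c *: D x.
Proof. by rewrite -[c *: x]addr0 derDZ der0 addr0. Qed.

Lemma derB D x y : D (x - y) = D x - D y.
Proof. by rewrite derD -scaleN1r derZ scaleN1r. Qed.

Lemma der1 D : D 1 = 0.
Proof.
by apply: (@addrI _ (D 1)); rewrite addr0 -{3}[1]mulr1 derM mulr1 mul1r.
Qed.

Lemma der_natr D n : D n%:R = 0.
Proof. by elim: n => [|n IHn]; rewrite ?der0 // -natr1 derD IHn der1 addr0. Qed.

Lemma der_bracket_subproof D1 D2 :
  (fun x => D1 (D2 x) - D2 (D1 x)) \in derivation.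
Proof.
apply/derivationP; split=> [c x y|x y].
- by rewrite !derDZ scalerBr opprD !addrA; congr (_ + _); rewrite addrAC.
- by rewrite !(derM, derD); ring.
Qed.

Definition der_bracket D1 D2 : Der := MkDer (der_bracket_subproof D1 D2).

Lemma der_addE D1 D2 x : (D1 + D2) x = D1 x + D2 x. Proof. by []. Qed.
Lemma der_scaleE c D x : (c *: D) x = c *: D x. Proof. by []. Qed.
Lemma der_zeroE x : (0 : Der) x = 0. Proof. by []. Qed.

Lemma der_bracketE D1 D2 x : der_bracket D1 D2 x = D1 (D2 x) - D2 (D1 x).
Proof. by []. Qed.

Lemma der_bracketDZl c D1 D2 D3 :
  der_bracket (c *: D1 + D2) D3 = c *: der_bracket D1 D3 + der_bracket D2 D3.
Proof.
apply: der_eq => x; rewrite !(der_addE, der_scaleE, der_bracketE).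
rewrite derDZ scalerBr opprD !addrA.
by congr (_ + _); rewrite addrAC.
Qed.

Lemma der_bracketxx D : der_bracket D D = 0.
Proof. by apply: der_eq => x; rewrite der_bracketE subrr der_zeroE. Qed.

Lemma der_bracketJ D1 D2 D3 :
  der_bracket (der_bracket D1 D2) D3 + der_bracket (der_bracket D2 D3) D1
    + der_bracket (der_bracket D3 D1) D2 = 0.
Proof.
apply: der_eq => x; rewrite !(der_addE, der_zeroE, der_bracketE, derB).
ring.
Qed.

HB.instance Definition _ :=
  Lmodule_isLieAlgebra.Build K Der der_bracketDZl der_bracketxx der_bracketJ.

Lemma der_mul_subproof a D : (fun x => a * D x) \in derivation.
Proof.
apply/derivationP; split=> [c x y|x y].
- by rewrite derDZ mulrDr scalerAr.
- by rewrite derM; ring.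
Qed.

Definition der_mul a D : Der := MkDer (der_mul_subproof a D).

End Derivations.

Arguments derivation {K A}.

Section Transport.
Context {K : comNzRingType} {A B : comAlgType K}.
Variables (f : {lrmorphism A -> B}) (g : {lrmorphism B -> A}).
Hypothesis gK : cancel g f.

Lemma der_conj_subproof (D : Der A) : f \o D \o g \in derivation.
Proof.
apply/derivationP; split=> [c x y|x y] /=.
- by rewrite linearP derDZ linearP.
- by rewrite rmorphM derM rmorphD !rmorphM /= !gK.
Qed.

Definition der_conj (D : Der A) : Der B := MkDer (der_conj_subproof D).

End Transport.

(** * Algebras given by generators and relations *)

Section Ideal.
Context {P : comNzRingType}.
Implicit Type rels : seq P.

Definition gen_ideal rels : {pred P} := fun x =>
  `[< exists c : 'I_(size rels) -> P, x = \sum_i c i * rels`_i >].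

Lemma gen_idealP rels x :
  reflect (exists c : 'I_(size rels) -> P, x = \sum_i c i * rels`_i)
          (x \in gen_ideal rels).
Proof. exact: asboolP. Qed.

Lemma gen_ideal0 rels : 0 \in gen_ideal rels.
Proof.
by apply/gen_idealP; exists (fun=> 0); rewrite big1 // => i _; rewrite mul0r.
Qed.

Lemma gen_idealDM rels a :
  {in gen_ideal rels &, forall u v, a * u + v \in gen_ideal rels}.
Proof.
move=> u v /gen_idealP[c ->] /gen_idealP[d ->].
apply/gen_idealP; exists (fun i => a * c i + d i).
by rewrite mulr_sumr -big_split; apply: eq_bigr => i _; rewrite mulrDl mulrA.
Qed.

Lemma mem_gen_ideal rels r : r \in rels -> r \in gen_ideal rels.
Proof.
move=> r_in; apply/gen_idealP.
have lt_r : (index r rels < size rels)%N by rewrite index_mem.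
exists (fun i => (i == Ordinal lt_r)%:R).
rewrite (bigD1 (Ordinal lt_r)) //= eqxx mul1r nth_index // big1 ?addr0 //.
by move=> i /negPf->; rewrite mul0r.
Qed.

End Ideal.

Record presentation (K : comNzRingType) := Presentation {
  ngens : nat;
  relators : seq {mpoly K[ngens]};
  relators_proper : 1 \notin gen_ideal relators }.

Section PresentedAlgebra.
Context {K : comNzRingType}.
Variable X : presentation K.
Local Notation n := (ngens X).
Local Notation P := {mpoly K[n]}.

Definition relator_ideal : {pred P} := gen_ideal (relators X).

Lemma relator_ideal_closed : idealr_closed relator_ideal.
Proof. by split; [exact: gen_ideal0|exact: relators_proper|exact: gen_idealDM]. Qed.

HB.instance Definition _ := isIdealr.Build P relator_ideal relator_ideal_closed.

Lemma relator_idealM a r : r \in relators X -> a * r \in relator_ideal.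
Proof. by move=> r_in; apply/idealMr/mem_gen_ideal. Qed.

Definition fpalg := {ideal_quot relator_ideal}.

HB.instance Definition _ := GRing.ComNzRing.on fpalg.

Definition fppi : P -> fpalg := \pi_{ideal_quot relator_ideal}.

Lemma fppi_is_zmod_morphism : zmod_morphism fppi.
Proof. exact: raddfB. Qed.
Lemma fppi_is_monoid_morphism : monoid_morphism fppi.
Proof. by split; [exact: rmorph1|exact: rmorphM]. Qed.

HB.instance Definition _ :=
  GRing.isZmodMorphism.Build P fpalg fppi fppi_is_zmod_morphism.
HB.instance Definition _ :=
  GRing.isMonoidMorphism.Build P fpalg fppi fppi_is_monoid_morphism.

Definition fprepr (x : fpalg) : P := repr (x : {ideal_quot relator_ideal}).

Lemma fpreprK x : fppi (fprepr x) = x.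
Proof. exact: reprK. Qed.

Lemma fppi_eq p q : (fppi p = fppi q) <-> (p - q \in relator_ideal).
Proof.
rewrite (Quotient.idealrBE relator_ideal); split; first by move/eqP.
by move/eqP.
Qed.

Lemma fppi_ind (Q : fpalg -> Prop) : (forall p, Q (fppi p)) -> forall x, Q x.
Proof. by move=> Qpi x; rewrite -[x]fpreprK. Qed.

Definition fpscale (c : K) (x : fpalg) : fpalg := fppi c%:MP * x.

Lemma fpscaleA a b x : fpscale a (fpscale b x) = fpscale (a * b) x.
Proof. by rewrite /fpscale mulrA -rmorphM mpolyCM. Qed.
Lemma fpscale1 : left_id 1 fpscale.
Proof. by move=> x; rewrite /fpscale rmorph1 mul1r. Qed.
Lemma fpscaleDr : right_distributive fpscale +%R.
Proof. by move=> a x y; rewrite /fpscale mulrDr. Qed.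
Lemma fpscaleDl x : {morph fpscale^~ x : a b / a + b}.
Proof. by move=> a b; rewrite /fpscale mpolyCD rmorphD mulrDl. Qed.

HB.instance Definition _ := GRing.Zmodule_isLmodule.Build K fpalg
  fpscaleA fpscale1 fpscaleDr fpscaleDl.

Lemma fpscaleAl (a : K) (x y : fpalg) : a *: (x * y) = (a *: x) * y.
Proof. exact: mulrA. Qed.

HB.instance Definition _ := GRing.Lmodule_isLalgebra.Build K fpalg fpscaleAl.
HB.instance Definition _ := GRing.Lalgebra_isComAlgebra.Build K fpalg.

(* Classically every commutative ring is a [comUnitRingType]; this gives access
   to inverses and integer powers of the invertible elements. *)
Definition fpunit : {pred fpalg} := fun x => `[< exists y, y * x = 1 >].
Definition fpinv (x : fpalg) : fpalg :=
  if pselect (exists y, y * x = 1) is left h then projT1 (cid h) else x.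

Lemma fpmulVr : {in fpunit, left_inverse 1 fpinv *%R}.
Proof.
move=> x /asboolP xU; rewrite /fpinv; case: pselect => // h.
exact: projT2 (cid h).
Qed.
Lemma fpunitP x y : y * x = 1 -> x \in fpunit.
Proof. by move=> xy; apply/asboolP; exists y. Qed.
Lemma fpinv_out : {in [predC fpunit], fpinv =1 id}.
Proof. by move=> x /asboolP nU; rewrite /fpinv; case: pselect. Qed.

HB.instance Definition _ := GRing.ComNzRing_hasMulInverse.Build fpalg
  fpmulVr fpunitP fpinv_out.

Lemma fppi_scalable : scalable fppi.
Proof. by move=> c p; rewrite -mul_mpolyC rmorphM. Qed.

HB.instance Definition _ :=
  GRing.isScalable.Build K P fpalg *:%R fppi fppi_scalable.

Definition fpgen (i : 'I_n) : fpalg := fppi 'X_i.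

(* The morphism sending each generator to [h i], when the relations hold. *)
Section Lift.
Variables (B : comAlgType K) (h : 'I_n -> B).
Local Notation ev := (mmap (in_alg B) h).
Hypothesis evr : {in relators X, forall r, ev r = 0}.

Definition fplift of {in relators X, forall r, ev r = 0} :=
  fun x : fpalg => ev (fprepr x).

Lemma fplift_pi p : fplift evr (fppi p) = ev p.
Proof.
apply/eqP; rewrite -subr_eq0 -rmorphB /=.
have /fppi_eq/gen_idealP[c ->] := fpreprK (fppi p).
rewrite rmorph_sum big1 // => i _.
by rewrite /= rmorphM /= (evr (mem_nth 0 (ltn_ord i))) mulr0.
Qed.

Lemma fplift_is_zmod_morphism : zmod_morphism (fplift evr).
Proof.
by elim/fppi_ind=> p; elim/fppi_ind=> q; rewrite -rmorphB !fplift_pi rmorphB.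
Qed.
Lemma fplift_is_monoid_morphism : monoid_morphism (fplift evr).
Proof.
split; first by rewrite -(rmorph1 fppi) fplift_pi rmorph1.
by elim/fppi_ind=> p; elim/fppi_ind=> q; rewrite -rmorphM !fplift_pi rmorphM.
Qed.
Lemma fplift_scalable : scalable (fplift evr).
Proof.
move=> c; elim/fppi_ind=> p.
by rewrite -linearZ !fplift_pi mmapZ /= -scalerAl mul1r.
Qed.

HB.instance Definition _ := GRing.isZmodMorphism.Build fpalg B (fplift evr)
  fplift_is_zmod_morphism.
HB.instance Definition _ := GRing.isMonoidMorphism.Build fpalg B (fplift evr)
  fplift_is_monoid_morphism.
HB.instance Definition _ := GRing.isScalable.Build K fpalg B *:%R (fplift evr)
  fplift_scalable.

Lemma fplift_gen i : fplift evr (fpgen i) = h i.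
Proof. by rewrite fplift_pi mmapX mmap1U. Qed.

End Lift.

Lemma fp_lrmorphism_eq (B : comAlgType K) (f1 f2 : {lrmorphism fpalg -> B}) :
  (forall i, f1 (fpgen i) = f2 (fpgen i)) -> f1 =1 f2.
Proof.
move=> eqf; elim/fppi_ind => p; rewrite [p]mpolyE !raddf_sum /=.
apply: eq_bigr => m _; rewrite !linearZ; congr (_ *: _).
rewrite mpolyXE_id !rmorph_prod; apply: eq_bigr => i _.
by rewrite !rmorphXn; congr (_ ^+ _); exact: eqf.
Qed.

(* The derivation sending each generator to [v i], when the ideal is stable. *)
Section LiftDer.
Variable (v : 'I_n -> P).

Lemma mpoly_der_subproof :
  (fun p : P => \sum_i v i * p^`M(i)) \in derivation.
Proof.
apply/derivationP; split=> [c p q|p q].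
- rewrite scaler_sumr -big_split; apply: eq_bigr => i _ /=.
  by rewrite linearP mulrDr scalerAr.
- rewrite mulr_suml mulr_sumr -big_split; apply: eq_bigr => i _ /=.
  by rewrite mderivM; ring.
Qed.

Definition mpoly_der : Der P := MkDer mpoly_der_subproof.

Lemma mpoly_der_gen i : mpoly_der 'X_i = v i.
Proof.
rewrite /= (bigD1 i) //= big1 => [|j ne_ji]; rewrite mderivX mnm1E.
  by rewrite eqxx -{1}[U_(i)%MM]add0m addmK mpolyX0 addr0 scale1r mulr1.
by rewrite eq_sym (negPf ne_ji) scale0r mulr0.
Qed.

Hypothesis stable : {in relators X, forall r, mpoly_der r \in relator_ideal}.

Let der_pi p : fppi (mpoly_der (fprepr (fppi p))) = fppi (mpoly_der p).
Proof.
apply/fppi_eq; rewrite -derB.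
have /fppi_eq/gen_idealP[c ->] := fpreprK (fppi p).
elim/big_rec: _ => [|i y _ yI]; first by rewrite der0 rpred0.
have ri : (relators X)`_i \in relators X by exact: mem_nth.
by rewrite derD derM !rpredD // idealMr //; [exact: mem_gen_ideal|exact: stable].
Qed.

Lemma fpder_subproof : (fun x => fppi (mpoly_der (fprepr x))) \in derivation.
Proof.
apply/derivationP; split=> [c|].
- elim/fppi_ind=> p; elim/fppi_ind=> q.
  by rewrite -linearP !der_pi -linearP derDZ.
- elim/fppi_ind=> p; elim/fppi_ind=> q.
  by rewrite -rmorphM !der_pi derM rmorphD !rmorphM.
Qed.

Definition fpder : Der fpalg := MkDer fpder_subproof.

Lemma fpder_pi p : fpder (fppi p) = fppi (mpoly_der p).
Proof. exact: der_pi. Qed.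

Lemma fpder_gen i : fpder (fpgen i) = fppi (v i).
Proof. by rewrite fpder_pi mpoly_der_gen. Qed.

End LiftDer.

End PresentedAlgebra.

Arguments relator_ideal {K} X.
Arguments fppi {K} X.
Arguments fpgen {K} X.

Lemma gen_ideal_proper (K : comNzRingType) n (rels : seq {mpoly K[n]})
    (v : 'I_n -> K) :
  {in rels, forall r, r.@[v] = 0} -> 1 \notin gen_ideal rels.
Proof.
move=> rels0; apply/negP => /gen_idealP[c /(congr1 (meval v))].
rewrite meval1 raddf_sum big1 => [|i _]; first by move/eqP; rewrite oner_eq0.
by rewrite /= mevalM (rels0 _ (mem_nth 0 (ltn_ord i))) mulr0.
Qed.


(** * The algebras R and S *)

Section RS.
Variable K : numFieldType.

Local Notation g0 := (@Ordinal 3 0 isT).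
Local Notation g1 := (@Ordinal 3 1 isT).
Local Notation g2 := (@Ordinal 3 2 isT).

Local Notation P := {mpoly K[3]}.

(* C[t, t^-1, u] / (u^2 - (t^2 + 4 t)), with generators t, t^-1, u. *)
Definition relsR : seq P :=
  [:: 'X_g0 * 'X_g1 - 1; 'X_g2 ^+ 2 - ('X_g0 ^+ 2 + 4 * 'X_g0)].

(* C[s, s^-1, (s-1)^-1], with generators s, s^-1, (s-1)^-1. *)
Definition relsS : seq P :=
  [:: 'X_g0 * 'X_g1 - 1; ('X_g0 - 1) * 'X_g2 - 1].

Lemma relsR_proper : 1 \notin gen_ideal relsR.
Proof.
apply: (@gen_ideal_proper _ _ _ (tnth [tuple -4; (-4)^-1; 0])) => r.
rewrite !inE => /orP[] /eqP->.
- rewrite mevalB mevalM !mevalXU meval1 /= mulfV ?subrr //.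
  by rewrite oppr_eq0 pnatr_eq0.
- rewrite mevalB mevalD !mevalM rmorph_nat !mevalXU /= !(tnth_nth 0) /=; ring.
Qed.

Lemma relsS_proper : 1 \notin gen_ideal relsS.
Proof.
apply: (@gen_ideal_proper _ _ _ (tnth [tuple 2; 2^-1; 1])) => r.
have n2 : (2 : K) != 0 by rewrite pnatr_eq0.
rewrite !inE => /orP[] /eqP->;
  rewrite !(mevalB, mevalM, mevalXU, meval1) !(tnth_nth 0) /=; first by rewrite mulfV ?subrr.
ring.
Qed.

Definition presR := Presentation relsR_proper.
Definition presS := Presentation relsS_proper.

Local Notation Rring := (fpalg presR).
Local Notation Sring := (fpalg presS).

Definition tR : Rring := fpgen presR g0.
Definition uR : Rring := fpgen presR g2.
Definition sS : Sring := fpgen presS g0.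

Lemma relsRP r : r \in relators presR ->
  r = 'X_g0 * 'X_g1 - 1 \/ r = 'X_g2 ^+ 2 - ('X_g0 ^+ 2 + 4 * 'X_g0).
Proof. by rewrite !inE => /orP[] /eqP->; [left|right]. Qed.
Lemma relsSP r : r \in relators presS ->
  r = 'X_g0 * 'X_g1 - 1 \/ r = ('X_g0 - 1) * 'X_g2 - 1.
Proof. by rewrite !inE => /orP[] /eqP->; [left|right]. Qed.

Lemma fppi_relator (X : presentation K) r : r \in relators X -> fppi X r = 0.
Proof.
move=> r_in; rewrite -(rmorph0 (fppi X)); apply/fppi_eq; rewrite subr0.
exact: mem_gen_ideal.
Qed.

Lemma tR_genV : tR * fpgen presR g1 = 1.
Proof.
apply/eqP; rewrite -subr_eq0; apply/eqP.
have := @fppi_relator presR ('X_g0 * 'X_g1 - 1).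
by rewrite !inE eqxx rmorphB rmorphM rmorph1; apply.
Qed.

Lemma uR_sqr : uR ^+ 2 = tR ^+ 2 + 4 * tR.
Proof.
apply/eqP; rewrite -subr_eq0; apply/eqP.
have := @fppi_relator presR ('X_g2 ^+ 2 - ('X_g0 ^+ 2 + 4 * 'X_g0)).
rewrite !inE eqxx orbT rmorphB rmorphD !rmorphXn rmorphM rmorph_nat.
by apply.
Qed.

Lemma sS_genV : sS * fpgen presS g1 = 1.
Proof.
apply/eqP; rewrite -subr_eq0; apply/eqP.
have := @fppi_relator presS ('X_g0 * 'X_g1 - 1).
by rewrite !inE eqxx rmorphB rmorphM rmorph1; apply.
Qed.

Lemma sS1_genV : (sS - 1) * fpgen presS g2 = 1.
Proof.
apply/eqP; rewrite -subr_eq0; apply/eqP.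
have := @fppi_relator presS (('X_g0 - 1) * 'X_g2 - 1).
by rewrite !inE eqxx orbT !(rmorphB, rmorphM, rmorph1); apply.
Qed.

Lemma tRV : fpgen presR g1 = tR^-1.
Proof. by rewrite (mulr1_eq tR_genV). Qed.
Lemma sSV : fpgen presS g1 = sS^-1.
Proof. by rewrite (mulr1_eq sS_genV). Qed.
Lemma sS1V : fpgen presS g2 = (sS - 1)^-1.
Proof. by rewrite (mulr1_eq sS1_genV). Qed.

Lemma tR_unit : tR \is a GRing.unit.
Proof. by apply/unitrPr; exists (fpgen presR g1); exact: tR_genV. Qed.
Lemma sS_unit : sS \is a GRing.unit.
Proof. by apply/unitrPr; exists (fpgen presS g1); exact: sS_genV. Qed.
Lemma sS1_unit : sS - 1 \is a GRing.unit.
Proof. by apply/unitrPr; exists (fpgen presS g2); exact: sS1_genV. Qed.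

(* D : t |-> u, t^-1 |-> - t^-2 u, u |-> t + 2 *)
Definition imD : 'I_3 -> P :=
  tnth [tuple 'X_g2; - ('X_g1 ^+ 2 * 'X_g2); 'X_g0 + 2].

Lemma imD_stable : {in relators presR, forall r,
  @mpoly_der K presR imD r \in relator_ideal presR}.
Proof.
move=> r /relsRP[]->.
- have -> : @mpoly_der K presR imD ('X_g0 * 'X_g1 - 1) =
      - ('X_g2 * 'X_g1) * ('X_g0 * 'X_g1 - 1) :> P.
    by rewrite derB derM !mpoly_der_gen der1 /imD !(tnth_nth 0) /=; ring.
  by apply: relator_idealM; rewrite !inE eqxx.
- have -> : @mpoly_der K presR imD ('X_g2 ^+ 2 - ('X_g0 ^+ 2 + 4 * 'X_g0)) = 0.
    by rewrite derB derD !expr2 !derM !mpoly_der_gen der_natr /imD !(tnth_nth 0) /=; ring.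
  exact: gen_ideal0.
Qed.

Definition derD_R : Der Rring := fpder imD_stable.

(* d/ds : s |-> 1, s^-1 |-> - s^-2, (s-1)^-1 |-> - (s-1)^-2 *)
Definition imds : 'I_3 -> P :=
  tnth [tuple 1; - 'X_g1 ^+ 2; - 'X_g2 ^+ 2].

Lemma imds_stable : {in relators presS, forall r,
  @mpoly_der K presS imds r \in relator_ideal presS}.
Proof.
move=> r /relsSP[]->.
- have -> : @mpoly_der K presS imds ('X_g0 * 'X_g1 - 1) =
      - 'X_g1 * ('X_g0 * 'X_g1 - 1) :> P.
    by rewrite derB derM !mpoly_der_gen der1 /imds !(tnth_nth 0) /=; ring.
  by apply: relator_idealM; rewrite !inE eqxx.
- have -> : @mpoly_der K presS imds (('X_g0 - 1) * 'X_g2 - 1) =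
      - 'X_g2 * (('X_g0 - 1) * 'X_g2 - 1) :> P.
    by rewrite derB derM derB !mpoly_der_gen der1 /imds !(tnth_nth 0) /=; ring.
  by apply: relator_idealM; rewrite !inE eqxx orbT.
Qed.

Definition dS : Der Sring := fpder imds_stable.

Lemma derD_Rt : derD_R tR = uR.
Proof. by rewrite [LHS]fpder_gen. Qed.
Lemma derD_Ru : derD_R uR = tR + 2.
Proof. by rewrite [LHS]fpder_gen /= rmorphD rmorph_nat. Qed.
Lemma dSs : dS sS = 1.
Proof. by rewrite [LHS]fpder_gen /= rmorph1. Qed.

(** * The isomorphism f *)

Definition imf : 'I_3 -> Sring :=
  tnth [tuple sS^-1 * (sS - 1) ^+ 2; (sS^-1 * (sS - 1) ^+ 2)^-1; sS - sS^-1].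

Lemma imf_rel : {in relators presR, forall r, mmap (in_alg Sring) imf r = 0}.
Proof.
move=> r /relsRP[]->.
- rewrite rmorphB rmorphM rmorph1 /= !mmapX !mmap1U /imf !(tnth_nth 0) /= mulrV ?subrr //.
  by rewrite unitrM unitrV unitrX ?sS_unit // sS1_unit.
- rewrite rmorphB rmorphD !rmorphXn rmorphM rmorph_nat /= !mmapX !mmap1U /imf !(tnth_nth 0) /=.
  have e := mulVr sS_unit.
  have -> : sS^-1 * (sS - 1) ^+ 2 = sS - 2 + sS^-1.
    have -> : sS^-1 * (sS - 1) ^+ 2 = (sS^-1 * sS) * (sS - 2) + sS^-1 by ring.
    by rewrite e mul1r.
  have -> : (sS - sS^-1) ^+ 2 - ((sS - 2 + sS^-1) ^+ 2 + 4 * (sS - 2 + sS^-1)) =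
    4 * (1 - sS^-1 * sS) by ring.
  by rewrite e subrr mulr0.
Qed.

Definition isoF : {lrmorphism Rring -> Sring} := fplift imf_rel.

Definition img : 'I_3 -> Rring :=
  tnth [tuple (tR + 2 + uR) / 2; (tR + 2 - uR) / 2; ((tR + 2 + uR) / 2 - 1)^-1].

Lemma unit2 (A : comUnitAlgType K) : (2 : A) \is a GRing.unit.
Proof.
by rewrite -scaler_nat scaler_unit ?unitr1 // unitfE pnatr_eq0.
Qed.

Lemma img_ab : (tR + 2 + uR) / 2 * ((tR + 2 - uR) / 2) = 1.
Proof.
have -> : (tR + 2 + uR) / 2 * ((tR + 2 - uR) / 2) =
  (2^-1 * 2) ^+ 2 - (uR ^+ 2 - (tR ^+ 2 + 4 * tR)) * 2^-1 ^+ 2 by ring.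
by rewrite uR_sqr (mulVr (unit2 Rring)) subrr mul0r subr0 expr1n.
Qed.

Lemma img_rel : {in relators presS, forall r, mmap (in_alg Rring) img r = 0}.
Proof.
have e := uR_sqr; have e2 := mulVr (unit2 Rring).
move=> r /relsSP[]->.
- by rewrite rmorphB rmorphM rmorph1 /= !mmapX !mmap1U /img !(tnth_nth 0) /= img_ab subrr.
- rewrite !(rmorphB, rmorphM, rmorph1) /= !mmapX !mmap1U /img !(tnth_nth 0) /= mulrV ?subrr //.
  apply/unitrPr; exists ((uR - tR) / 2 * tR^-1).
  have -> : ((tR + 2 + uR) / 2 - 1) = (tR + uR) / 2 + (2^-1 * 2 - 1) by ring.
  rewrite e2 subrr addr0.
  have -> : (tR + uR) / 2 * ((uR - tR) / 2 * tR^-1) =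
    (uR ^+ 2 - (tR ^+ 2 + 4 * tR)) * 2^-1 ^+ 2 * tR^-1
     + (2^-1 * 2) ^+ 2 * (tR^-1 * tR) by ring.
  by rewrite e e2 subrr !mul0r add0r expr1n mul1r mulVr ?tR_unit.
Qed.

Definition isoG : {lrmorphism Sring -> Rring} := fplift img_rel.

Lemma isoFt : isoF tR = sS^-1 * (sS - 1) ^+ 2.
Proof. exact: fplift_gen. Qed.
Lemma isoFu : isoF uR = sS - sS^-1.
Proof. exact: fplift_gen. Qed.
Lemma isoGs : isoG sS = (tR + 2 + uR) / 2.
Proof. exact: fplift_gen. Qed.
Lemma isoGsV : isoG sS^-1 = (tR + 2 - uR) / 2.
Proof. by rewrite -sSV [LHS]fplift_gen. Qed.


Lemma ord3P (Q : 'I_3 -> Prop) : Q g0 -> Q g1 -> Q g2 -> forall i, Q i.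
Proof.
move=> Q0 Q1 Q2 [[|[|[|//]]] lti].
- by rewrite (_ : Ordinal lti = g0) //; apply: val_inj.
- by rewrite (_ : Ordinal lti = g1) //; apply: val_inj.
- by rewrite (_ : Ordinal lti = g2) //; apply: val_inj.
Qed.

Lemma isoGK : cancel isoG isoF.
Proof.
suff gen i : (isoF \o isoG) (fpgen presS i) = idfun (fpgen presS i).
  by move=> x; exact: (fp_lrmorphism_eq gen x).
have FGs : isoF (isoG sS) = sS.
  rewrite isoGs rmorphM rmorphV ?unit2 //= rmorphD rmorphD rmorph_nat /=.
  rewrite isoFt isoFu rmorph_nat; apply: (canLR (mulrK (unit2 Sring))).
  have -> : sS^-1 * (sS - 1) ^+ 2 = (sS^-1 * sS) * (sS - 2) + sS^-1 by ring.
  by rewrite (mulVr sS_unit); ring.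
move: i; apply: ord3P; rewrite ?sSV ?sS1V /=.
- exact: FGs.
- by rewrite (rmorphV _ sS_unit) /= (rmorphV _ (rmorph_unit _ sS_unit)) /= FGs.
- rewrite (rmorphV _ sS1_unit) /= (rmorphV _ (rmorph_unit _ sS1_unit)) /=.
  by rewrite !rmorphB !rmorph1 /= FGs.
Qed.

Lemma isoFK : cancel isoF isoG.
Proof.
suff gen i : (isoG \o isoF) (fpgen presR i) = idfun (fpgen presR i).
  by move=> x; exact: (fp_lrmorphism_eq gen x).
have e2 := mulVr (unit2 Rring).
have GFt : isoG (isoF tR) = tR.
  rewrite isoFt rmorphM rmorphXn rmorphB rmorph1 /= isoGsV isoGs.
  set a := (tR + 2 + uR) / 2; set b := (tR + 2 - uR) / 2.
  have -> : b * (a - 1) ^+ 2 = (a * b - 1) * (a - 2) + a + b - 2 by ring.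
  rewrite img_ab subrr mul0r add0r.
  have -> : a + b - 2 = (tR + 2) * (2^-1 * 2) - 2 by rewrite /a /b; ring.
  by rewrite e2; ring.
have GFu : isoG (isoF uR) = uR.
  rewrite isoFu rmorphB /= isoGsV isoGs.
  have -> : (tR + 2 + uR) / 2 - (tR + 2 - uR) / 2 = (2^-1 * 2) * uR by ring.
  by rewrite e2 mul1r.
move: i; apply: ord3P; rewrite ?tRV /=.
- exact: GFt.
- by rewrite (rmorphV _ tR_unit) /= (rmorphV _ (rmorph_unit _ tR_unit)) /= GFt.
- exact: GFu.
Qed.

Definition PhiF : Der Rring -> Der Sring := der_conj isoGK.

Lemma PhiFE (d : Der Rring) x : PhiF d x = isoF (d (isoG x)).
Proof. by []. Qed.

(** * The functions phi_1, phi_2 *)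

Definition eR (k : int) : Der Rring := der_mul (tR ^ k) derD_R.
Definition dR (k : int) : Der Rring := der_mul (tR ^ k * uR) derD_R.

Definition sder (k : int) : Der Sring := der_mul (sS ^ k) dS.
Definition s1der (l : int) : Der Sring := der_mul ((sS - 1) ^ l) dS.

Implicit Types phi : Der Sring -> Der Sring -> K.

(* The basis of Der(S) is {sder k, k : int} together with {s1der (- l), l >= 1}.
   The last two clauses below list the pairs of basis elements not covered,
   up to skew-symmetry, by the clauses before them. *)
Definition is_phi1 phi : Prop :=
  bilinear_for *%R *%R phi /\
  [/\ forall x y, phi x y = - phi y x,
      forall k l : int,
        phi (sder (k + 1)) (sder (- l + 1)) = (k == l)%:R * (l ^+ 3 - l)%:~R,
      forall k l : nat, (1 <= k)%N -> (1 <= l)%N ->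
        phi (sder (- k%:Z)) (s1der (- l%:Z)) =
          (-1) ^+ (l + 1) * (k + l + 1)`!%:R / ((k - 1)`! * (l - 1)`!)%:R,
      forall k l : nat, (1 <= l)%N -> phi (sder k) (s1der (- l%:Z)) = 0
    & forall k l : nat, (1 <= k)%N -> (1 <= l)%N ->
        phi (s1der (- k%:Z)) (s1der (- l%:Z)) = 0].

(* When l = 0 or l = 1, [s1der (- l + 1)] is not one of the s1der basis vectors
   but equals sder 1 - sder 0, resp. sder 0, and the value prescribed is 0. *)
Definition is_phi2 phi : Prop :=
  [/\ bilinear_for *%R *%R phi,
      forall x y, phi x y = - phi y x,
      forall k l : nat,
        phi (sder (k%:Z + 1)) (s1der (- l%:Z + 1)) =
          'C(k + 1, l + 1)%:R * (l%:Z ^+ 3 - l%:Z)%:~R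
    & forall k l : nat, (1 <= k)%N -> (1 <= l)%N ->
        phi (s1der (- k%:Z)) (sder (- l%:Z)) =
          (-1) ^+ (k + 1) * (k + l + 1)`!%:R / ((k - 1)`! * (l - 1)`!)%:R] /\
  [/\ forall k l : int, phi (sder k) (sder l) = 0,
      forall l : nat, (1 <= l)%N -> phi (sder 0) (s1der (- l%:Z)) = 0
    & forall k l : nat, (1 <= k)%N -> (1 <= l)%N ->
        phi (s1der (- k%:Z)) (s1der (- l%:Z)) = 0].

(* Each predicate prescribes a bilinear function on all pairs of basis elements,
   so it has at most one solution. *)
Definition phi1 : Der Sring -> Der Sring -> K :=
  xget (fun _ _ => 0) [set phi | is_phi1 phi].
Definition phi2 : Der Sring -> Der Sring -> K :=
  xget (fun _ _ => 0) [set phi | is_phi2 phi].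

Definition phibar1 (x y : Der Rring) : K := phi1 (PhiF x) (PhiF y).
Definition phibar2 (x y : Der Rring) : K := phi2 (PhiF x) (PhiF y).

(** * Double factorials of odd integers, inverse factorials of integers *)

(* [Negz n] is - n.+1; for negative odd m the recursion m!! = m (m-2)!! gives
   m!! = \prod_(i odd, 1 <= i < - m) (- i)^-1. Even m are not meaningful. *)
Definition dblfact (m : int) : K :=
  match m with
  | Posz n => \prod_(i < n.+1 | odd i) i%:R
  | Negz n => \prod_(i < n | odd i) (- i%:R)^-1
  end.

Lemma dblfactN1 : dblfact (-1) = 1.
Proof. by rewrite /= big_ord0. Qed.

Lemma dblfact_rec (j : int) :
  dblfact (2 * j + 1) = (2 * j + 1)%:~R * dblfact (2 * j - 1).
Proof.
case: j => n.
- have -> : 2 * n%:Z + 1 = Posz n.*2.+1 by lia.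
  case: n => [|n].
    by rewrite /= big_mkcond !big_ord_recr !big_ord0 /= !mul1r.
  have -> : 2 * n.+1%:Z - 1 = Posz n.*2.+1 by lia.
  rewrite /= [LHS]big_mkcond [in RHS]big_mkcond !big_ord_recr /= odd_double /=.
  by rewrite !mulr1 mulrC.
- have -> : 2 * Negz n + 1 = Negz n.*2 by lia.
  have -> : 2 * Negz n - 1 = Negz n.*2.+2 by lia.
  rewrite /= big_mkcond [in RHS]big_mkcond !big_ord_recr /= odd_double /= mulr1.
  rewrite NegzE mulrNz mulrCA -[- _ * _]/(- _ * _).
  by rewrite mulfV ?mulr1 // oppr_eq0 pnatr_eq0.
Qed.

Definition invfact (n : int) : K :=
  if n is Posz m then m`!%:R^-1 else 0.

End RS.

Arguments phi1 : clear implicits.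
Arguments phi2 : clear implicits.
Arguments phibar1 : clear implicits.
Arguments phibar2 : clear implicits.

(* Main.v *)
Require Import Defs.
From mathcomp Require Import all_boot all_order all_algebra.
From mathcomp Require Import reals complex.
From HB Require Import structures.
From mathcomp Require Import sesquilinear boolp classical_sets ssrcomplements.
From mathcomp Require Import mpoly ring zify.

(** Both functions phi_1, phi_2 are Gelfand-Fuchs forms:
    phi_i (f d/ds, g d/ds) = Res_i (f''' g ds), where Res_1 is the residue at
    s = 0 and Res_2 the residue at s = 1.  Such a form is a cocycle because a
    residue kills derivatives: f''' g + g''' f is a derivative, and so is the
    cyclic sum that the Jacobi-type identity asks to vanish.

    A residue is a linear functional on S.  The powers of s and the negative
    powers of s - 1 form a basis of S, so a functional can be prescribed freely
    on them ([Sfun]) and is determined by these values ([Sring_ind]); on this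
    basis it is immediate that the residues kill derivatives.  Their values on
    the products s^n (s - 1)^-c are binomial coefficients ([res0_pole],
    [res1_pole] and so on), and comparing them with the tables that define
    phi_1 and phi_2 gives [phi1E] and [phi2E].

    Under f : R -> S the derivation D becomes the Euler derivation s d/ds, and
    s^2 (s a)''' = (s d/ds)^3 a - (s d/ds) a.  Hence
      phibar_i (a D, b D) = rho_i ((D^3 a - D a) b),
      rho_i (a) = Res_i (f(a) ds / s),
    a computation inside R ([gf_form_conj]).  As rho_i kills D(R), the
    identities D(t^n) = n t^(n-1) u and
    D(t^n u) = (n+1) t^(n+1) + (4n+2) t^n show that rho_i (t^n u) vanishes
    unless n = -1, and that
      (n+1) rho_i (t^(n+1)) = - (4n+2) rho_i (t^n),
    which is solved by rho_i (t^n) = rho_i (1) (-2)^n (2n-1)!! / n!.  The forms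
    thus depend only on the two numbers rho_i (t^-1 u), which are -1 and 2, and
    rho_i (1), which are 1 and 0: this explains the factor -2 between the two
    tables and the vanishing of phibar_2 (e_k, d_l).

    Finally [e_k, e_(-k)] = -2k d_(-1), while phibar_i (e_k, e_(-k)) is a
    nonzero multiple of k^3 - k.  If phibar_i were h of the bracket, k = 1 would
    give h (d_(-1)) = 0, which contradicts k = 2. *)

Set Implicit Arguments.
Unset Strict Implicit.
Unset Printing Implicit Defensive.

Import GRing.Theory Num.Theory.
Local Open Scope ring_scope.

(** * Derivatives of integer powers *)

Section DerPowers.
Lemma derN (K : comNzRingType) (A : comAlgType K) (D : Der A) x :
  D (- x) = - D x.
Proof. by rewrite -sub0r derB der0 sub0r. Qed.

Variables (K : comNzRingType) (A : comUnitAlgType K).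
Implicit Types (D : Der A) (x : A).

Lemma derV D x : x \is a GRing.unit -> D x^-1 = - (x^-1 ^+ 2 * D x).
Proof.
move=> xU; have e := mulVr xU; have := der1 D; rewrite -{1}e derM => De.
have -> : D x^-1 = (x^-1 * x) * D x^-1 by rewrite e mul1r.
have -> : x^-1 * x * D x^-1 =
  x^-1 * (D x^-1 * x + x^-1 * D x) - x^-1 ^+ 2 * D x by ring.
by rewrite De mulr0 sub0r.
Qed.

Lemma derX D x n : D (x ^+ n.+1) = n.+1%:R * (x ^+ n * D x).
Proof.
elim: n => [|k IHk]; first by rewrite expr1 expr0 !mul1r.
by rewrite exprS derM IHk -[k.+2]add1n natrD exprS; ring.
Qed.

Lemma derXz D x (n : int) :
  x \is a GRing.unit -> D (x ^ n) = n%:~R * (x ^ (n - 1) * D x).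
Proof.
move=> xU; case: n => [[|n]|n].
- by rewrite expr0z der1 mul0r.
- by rewrite -exprnP derX (_ : n.+1%:Z - 1 = n); [|lia].
have -> : Negz n - 1 = - (n.+2 : int) by lia.
rewrite NegzE -!exprz_inv -!exprnP derX derV //.
by rewrite mulrNz -pmulrn !exprS expr0; ring.
Qed.

Lemma der_intl D (n : int) x : D (n%:~R * x) = n%:~R * D x.
Proof.
have natl m : D (m%:R * x) = m%:R * D x.
  by rewrite derM der_natr mul0r add0r.
case: n => n; first by rewrite -pmulrn natl.
by rewrite NegzE mulrNz -pmulrn !mulNr derN natl.
Qed.

Lemma scalar_intl (F : {scalar A}) (n : int) x :
  F (n%:~R * x) = n%:~R * F x.
Proof. by rewrite !mulrzl raddfMz. Qed.

End DerPowers.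

(** * Linear extension from monomials *)

Section MonomialExtension.
Variables (K : comNzRingType) (n : nat) (v : 'X_{1..n} -> K).

Definition monext (p : {mpoly K[n]}) : K := \sum_(m <- msupp p) p@_m * v m.

(** Summing over all monomials of bounded degree makes the range independent of
    the polynomial, so that linearity becomes visible. *)
Lemma monextE k p : (msize p <= k)%N ->
  monext p = \sum_(m : 'X_{1..n < k}) p@_m * v m.
Proof.
move=> le_pk; rewrite /monext (big_mksub ('X_{1..n < k}))/=; first last.
- by move=> m /msize_mdeg_lt /leq_trans; apply.
- exact: msupp_uniq.
by rewrite big_rmcond // => m /memN_msupp_eq0->; rewrite mul0r.
Qed.

Lemma monext_scalar : scalar monext.
Proof.
move=> c p q; set k := maxn (msize (c *: p + q)) (maxn (msize p) (msize q)).
rewrite !(@monextE k) ?leq_max ?leqnn ?orbT //.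
rewrite mulr_sumr -big_split; apply: eq_bigr => m _ /=.
by rewrite mcoeffD mcoeffZ mulrDl mulrA.
Qed.

HB.instance Definition _ := GRing.isLinear.Build K _ K *%R monext monext_scalar.

Lemma monextX m : monext 'X_[m] = v m.
Proof. by rewrite /monext msuppX big_seq1 mcoeffX eqxx mul1r. Qed.

End MonomialExtension.

(** * A basis of S, and the linear functionals on S *)

Section Basis.
Variable K : numFieldType.

Local Notation g0 := (@Ordinal 3 0 isT).
Local Notation g1 := (@Ordinal 3 1 isT).
Local Notation g2 := (@Ordinal 3 2 isT).
Local Notation P := {mpoly K[3]}.
Local Notation Sring := (fpalg (presS K)).
Local Notation s := (sS K).
Local Notation w := (sS K - 1).

Lemma exprzS_s (n : int) : s ^ (n + 1) = s ^ n * s.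
Proof. by rewrite exprzDr ?sS_unit // expr1z. Qed.

(** Multiply 1 = s - (s - 1) by a monomial: this partial fraction
    step drives the recursions in the pole order at 1. *)
Lemma pole_split (n : int) c :
  s ^ (n + 1) * w ^- c.+1 = s ^ n * w ^- c.+1 + s ^ n * w ^- c.
Proof.
have e := mulVr (sS1_unit K).
rewrite exprzS_s -!exprVn exprS.
have -> : s ^ n * s * (w^-1 * w^-1 ^+ c) =
  s ^ n * (w^-1 * w^-1 ^+ c) + (w^-1 * w) * (s ^ n * w^-1 ^+ c) by ring.
by rewrite e mul1r.
Qed.

Lemma monomS (m : 'X_{1..3}) :
  fppi (presS K) ('X_[m] : P) = s ^ ((m g0)%:Z - (m g1)%:Z) * w ^- m g2.
Proof.
rewrite mpolyXE_id rmorph_prod /= big_ord_recl big_ord_recl big_ord_recl big_ord0.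
have -> : lift ord0 (lift ord0 ord0) = g2 by apply: val_inj.
have -> : lift ord0 (ord0 : 'I_2) = g1 by apply: val_inj.
have -> : ord0 = g0 by apply: val_inj.
rewrite !rmorphXn mulr1 mulrA /=.
rewrite -/(fpgen (presS K) g0) -/(fpgen (presS K) g1) -/(fpgen (presS K) g2) sSV sS1V.
rewrite -/s.
rewrite exprzDr ?sS_unit // -exprz_inv.
by rewrite -!exprnP [w^-1 ^+ _]exprVn.
Qed.

(** The powers of s and the negative powers of s - 1 span S: [pole_split] moves
    the exponent of s towards 0 while lowering the order of the pole at 1. *)
Lemma Sring_ind (Q : Sring -> Prop) :
  (forall c x y, Q x -> Q y -> Q (c *: x + y)) ->
  (forall k : int, Q (s ^ k)) -> (forall l, Q (w ^- l.+1)) ->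
  forall x, Q x.
Proof.
move=> Ql Qs Qw.
have Q0 : Q 0 by have := Ql (-1) _ _ (Qs 0) (Qs 0); rewrite scaleN1r addNr.
have QD x y : Q x -> Q y -> Q (x + y).
  by move=> Qx Qy; have := Ql 1 _ _ Qx Qy; rewrite scale1r.
have QB x y : Q x -> Q y -> Q (x - y).
  by move=> Qx Qy; have := Ql (-1) _ _ Qy Qx; rewrite scaleN1r addrC.
have Qsw c : forall n : int, Q (s ^ n * w ^- c).
  elim: c => [|c IHc]; first by move=> n; rewrite expr0 invr1 mulr1.
  elim/int_rec => [|n IHn|n IHn]; first by rewrite expr0z mul1r.
    by rewrite -addn1 PoszD pole_split; apply: QD.
  have := pole_split (- n.+1%:Z) c.
  rewrite (_ : - n.+1%:Z + 1 = - n%:Z); last by lia.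
  by move/(canLR (addrK _)) <-; apply: QB.
move=> x; rewrite -[x]fpreprK [fprepr x]mpolyE raddf_sum /=.
elim/big_rec: _ => // m y _ Qy; rewrite linearZ /=; apply: Ql => //.
by rewrite monomS.
Qed.

Section Functional.
Variables (alpha : int -> K) (beta : nat -> K).

(** The value at s^n (s - 1)^-c forced by [alpha] on the powers of s and by [beta]
    on the negative powers of s - 1.  By [pole_split] it is, as a function of n, a
    discrete antiderivative of the value for c - 1; its constant of integration,
    the value at n = 0, is read from [beta]. *)
Fixpoint monval (c : nat) (n : int) : K :=
  if c is c'.+1 then
    beta c' + match n with
              | Posz m => \sum_(j < m) monval c' j
              | Negz m => - \sum_(j < m.+1) monval c' (Negz j)
              end
  else alpha n.

Lemma monvalS c n : monval c.+1 (n + 1) = monval c.+1 n + monval c n.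
Proof.
case: n => [n|[|n]].
- have -> : n%:Z + 1 = n.+1 by lia.
  by rewrite /= big_ord_recr addrA.
- have -> : Negz 0 + 1 = 0%N by lia.
  by rewrite /= big_ord0 big_ord1 addr0 subrK.
have -> : Negz n.+1 + 1 = Negz n by lia.
by rewrite /= [in RHS]big_ord_recr /= opprD !addrA subrK.
Qed.

Definition monval_mnm (m : 'X_{1..3}) : K :=
  monval (m g2) ((m g0)%:Z - (m g1)%:Z).

(** The relation between s and s^-1 is respected because only the difference of
    their exponents matters, the one between s - 1 and its inverse by [monvalS]. *)
Lemma monext_relator r : r \in relators (presS K) ->
  forall c, monext monval_mnm (c * r) = 0.
Proof.
move=> r_in c; rewrite [c]mpolyE mulr_suml linear_sum big1 //= => m _.
rewrite -scalerAl linearZ /=; apply/eqP; rewrite mulf_eq0; apply/orP; right.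
apply/eqP; case: (relsSP r_in) => -> {r_in}.
  rewrite mulrBr mulr1 -!mpolyXD linearB /= !monextX /monval_mnm.
  rewrite !mnmDE !mnm1E /=.
  by apply/eqP; rewrite subr_eq0; apply/eqP; congr monval; lia.
rewrite mulrBr mulr1 mulrBl mul1r mulrBr -!mpolyXD !linearB /= !monextX.
rewrite /monval_mnm !mnmDE !mnm1E /= !(addn0, add0n) [(m g2 + 1)%N]addn1.
have -> : (m g0 + 1)%N%:Z - (m g1)%:Z = ((m g0)%:Z - (m g1)%:Z) + 1 by lia.
by rewrite monvalS addrAC addrK subrr.
Qed.

(** Linear independence of the basis, in dual form: a functional on S with
    arbitrary values [alpha] and [beta] on the basis vectors. *)
Definition Sfun (x : Sring) : K := monext monval_mnm (fprepr x).

Lemma Sfun_pi p : Sfun (fppi (presS K) p) = monext monval_mnm p.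
Proof.
apply/eqP; rewrite -subr_eq0 -linearB /=; apply/eqP.
have /fppi_eq/gen_idealP[c ->] := fpreprK (fppi (presS K) p).
rewrite linear_sum big1 //= => i _.
exact/monext_relator/mem_nth.
Qed.

Lemma Sfun_scalar : scalar Sfun.
Proof.
move=> c x y; rewrite -[x]fpreprK -[y]fpreprK -linearP !Sfun_pi.
exact: linearP.
Qed.

HB.instance Definition _ := GRing.isLinear.Build K Sring K *%R Sfun Sfun_scalar.

Lemma Sfun_sw (n : int) c : Sfun (s ^ n * w ^- c) = monval c n.
Proof.
pose m a b := [multinom tnth [tuple a; b; c] i | i < 3].
have Em a b : Sfun (s ^ (a%:Z - b%:Z) * w ^- c) = monval c (a%:Z - b%:Z).
  have := monomS (m a b); rewrite !mnmE /= !(tnth_nth 0%N) /= => <-.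
  by rewrite Sfun_pi monextX /monval_mnm !mnmE !(tnth_nth 0%N).
case: n => n; first by have := Em n 0%N; rewrite subr0.
by have := Em 0%N n.+1; rewrite sub0r NegzE.
Qed.

End Functional.
End Basis.

(** * The Gelfand-Fuchs form of a functional that kills derivatives *)

Section GelfandFuchs.
Variables (K : comNzRingType) (A : comAlgType K) (D : Der A) (F : {scalar A}).
Hypothesis FD : forall x, F (D x) = 0.

Definition gf_form (f g : A) : K := F (D (D (D f)) * g).

Lemma gf_form_bilinear : bilinear_for *%R *%R gf_form.
Proof.
split=> [g c f1 f2 | f c g1 g2]; rewrite /gf_form.
  by rewrite !derDZ mulrDl -scalerAl linearP.
by rewrite mulrDr -scalerAr linearP.
Qed.

(** f''' g + g''' f is the derivative of f'' g - f' g' + f g''. *)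
Lemma gf_form_skew f g : gf_form f g = - gf_form g f.
Proof.
apply/eqP; rewrite -subr_eq0 opprK -raddfD /=; apply/eqP.
rewrite -(FD (D (D f) * g - D f * D g + f * D (D g))).
by congr (F _); rewrite !(derM, derN, derD); ring.
Qed.

(** The terms of order four cancel in the cyclic sum, which leaves twice the cyclic
    sum of h (f' g'' - f'' g')'.  That is a derivative, because the cyclic sum of
    h' (f' g'' - f'' g') is a determinant with two equal rows. *)
Lemma gf_form_cocycle f g h :
  gf_form (f * D g - g * D f) h + gf_form (g * D h - h * D g) f
    + gf_form (h * D f - f * D h) g = 0.
Proof.
pose T a b c := c * (D a * D (D b) - D (D a) * D b).
rewrite -!raddfD /= -(FD (2 * (T f g h + T g h f + T h f g))).
congr (F _); rewrite derM der_natr mul0r add0r /T.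
by rewrite !(derM, derN, derD); ring.
Qed.

End GelfandFuchs.

(** * Residues at 0 and 1 *)

Section Residues.
Variable K : numFieldType.
Local Notation Sring := (fpalg (presS K)).
Local Notation s := (sS K).
Local Notation w := (sS K - 1).
Local Notation ds := (dS K).

Lemma Sfun_s alpha beta (n : int) : Sfun alpha beta (s ^ n) = alpha n.
Proof. by have := Sfun_sw alpha beta n 0; rewrite expr0 invr1 mulr1. Qed.

Lemma Sfun_w alpha beta c : Sfun alpha beta (w ^- c.+1) = beta c.
Proof.
have := Sfun_sw alpha beta 0 c.+1; rewrite expr0z mul1r => ->.
by rewrite /= big_ord0 addr0.
Qed.

Lemma ds_s (n : int) : ds (s ^ n) = n%:~R * s ^ (n - 1).
Proof. by rewrite (derXz _ _ (sS_unit K)) dSs mulr1. Qed.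

Lemma ds_w (n : int) : ds (w ^ n) = n%:~R * w ^ (n - 1).
Proof. by rewrite (derXz _ _ (sS1_unit K)) derB dSs der1 subr0 mulr1. Qed.

Lemma d3s_s (n : int) :
  ds (ds (ds (s ^ n))) = (n * (n - 1) * (n - 2))%:~R * s ^ (n - 3).
Proof.
rewrite !(der_intl, ds_s) !mulrA -!intrM.
by congr (_%:~R * _ ^ _); lia.
Qed.

Lemma d3s_w (n : int) :
  ds (ds (ds (w ^ n))) = (n * (n - 1) * (n - 2))%:~R * w ^ (n - 3).
Proof.
rewrite !(der_intl, ds_w) !mulrA -!intrM.
by congr (_%:~R * _ ^ _); lia.
Qed.

(** The derivatives of the basis vectors are multiples of the s^k with k <> -1 and
    of the (s - 1)^-c with c >= 2, and s^0 has derivative 0. *)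
Lemma Sfun_ds alpha beta :
    (forall n : int, n != -1 -> alpha n = 0) -> (forall c, beta c.+1 = 0) ->
  forall x, Sfun alpha beta (ds x) = 0.
Proof.
move=> a0 b0; apply: Sring_ind => [c x y x0 y0 | k | l].
- by rewrite derDZ linearP /= x0 y0 mulr0 addr0.
- rewrite ds_s scalar_intl /= Sfun_s; have [->|k0] := eqVneq k 0.
    by rewrite mul0r.
  by rewrite a0 ?mulr0 //; lia.
rewrite exprnN ds_w scalar_intl /= (_ : - l.+1%:Z - 1 = - l.+2%:Z); last by lia.
by rewrite -exprnN Sfun_w b0 mulr0.
Qed.

(** Near 0 the functions (s - 1)^-c are regular, so among the basis vectors only
    s^-1 has a residue there. *)
Definition res0 : {scalar Sring} :=
  Sfun (fun n : int => (n == -1)%:R) (fun=> 0).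
(** Near 1 the powers of s are regular, so only (s - 1)^-1 has a residue. *)
Definition res1 : {scalar Sring} := Sfun (fun=> 0) (fun c => (c == 0%N)%:R).

Lemma res0_ds x : res0 (ds x) = 0.
Proof. by apply: Sfun_ds => // n /negPf->. Qed.
Lemma res1_ds x : res1 (ds x) = 0.
Proof. exact: Sfun_ds. Qed.

Lemma res0_s (n : int) : res0 (s ^ n) = (n == -1)%:R.
Proof. exact: Sfun_s. Qed.
Lemma res0_w c : res0 (w ^- c.+1) = 0.
Proof. exact: Sfun_w. Qed.
Lemma res1_s (n : int) : res1 (s ^ n) = 0.
Proof. exact: Sfun_s. Qed.
Lemma res1_w c : res1 (w ^- c.+1) = (c == 0%N)%:R.
Proof. exact: Sfun_w. Qed.

Lemma res0_regular (n c : nat) : res0 (s ^ n * w ^- c.+1) = 0.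
Proof.
elim: c n => [|c IHc]; elim=> [|n IHn]; rewrite ?expr0z ?mul1r ?res0_w //;
  rewrite -addn1 PoszD pole_split raddfD /= IHn add0r ?IHc //.
by rewrite expr0 invr1 mulr1 res0_s.
Qed.

(** The coefficient of s^m in (s - 1)^-(c+1), by Pascal's rule. *)
Lemma res0_pole (m c : nat) :
  res0 (s ^ (- m.+1%:Z) * w ^- c.+1) = (-1) ^+ c.+1 * 'C(c + m, m)%:R.
Proof.
have rec k d : res0 (s ^ (- k.+1%:Z) * w ^- d.+1) =
    res0 (s ^ (- k%:Z) * w ^- d.+1) - res0 (s ^ (- k.+1%:Z) * w ^- d).
  have := pole_split K (- k.+1%:Z) d.
  rewrite (_ : - k.+1%:Z + 1 = - k%:Z); last by lia.
  by move=> ->; rewrite raddfD /= addrK.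
elim: c m => [|c IHc]; elim=> [|m IHm]; rewrite rec.
- rewrite expr0z mul1r res0_w expr0 invr1 mulr1 res0_s.
  by rewrite eqxx bin0 sub0r expr1 mulr1.
- rewrite IHm expr0 invr1 mulr1 res0_s (_ : _ == _ = false); last by lia.
  by rewrite subr0 !add0n !binn.
- by rewrite expr0z mul1r res0_w IHc !bin0 !mulr1 sub0r [in RHS]exprS mulN1r.
by rewrite IHm IHc [in RHS]addSn binS addSnnS natrD !exprS; ring.
Qed.

(** The coefficient of (s - 1)^c in s^n = (1 + (s - 1))^n. *)
Lemma res1_regular (n c : nat) : res1 (s ^ n * w ^- c.+1) = 'C(n, c)%:R.
Proof.
elim: n c => [|n IHn] c; first by rewrite expr0z mul1r res1_w bin0n.
rewrite -addn1 PoszD pole_split raddfD /= IHn addn1.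
case: c => [|c]; last by rewrite IHn binS natrD.
by rewrite expr0 invr1 mulr1 res1_s addr0 !bin0.
Qed.

(** The coefficient of (s - 1)^c in s^-(m+1). *)
Lemma res1_pole (m c : nat) :
  res1 (s ^ (- m.+1%:Z) * w ^- c.+1) = (-1) ^+ c * 'C(m + c, c)%:R.
Proof.
have rec k d : res1 (s ^ (- k.+1%:Z) * w ^- d.+1) =
    res1 (s ^ (- k%:Z) * w ^- d.+1) - res1 (s ^ (- k.+1%:Z) * w ^- d).
  have := pole_split K (- k.+1%:Z) d.
  rewrite (_ : - k.+1%:Z + 1 = - k%:Z); last by lia.
  by move=> ->; rewrite raddfD /= addrK.
elim: c m => [|c IHc]; elim=> [|m IHm]; rewrite rec.
- by rewrite expr0z mul1r res1_w expr0 invr1 mulr1 res1_s eqxx bin0 subr0 mulr1.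
- by rewrite IHm expr0 invr1 mulr1 res1_s subr0 !bin0.
- by rewrite expr0z mul1r res1_w IHc sub0r !add0n !binn !mulr1 [in RHS]exprS mulN1r.
by rewrite IHm IHc [in RHS]addSn binS addSnnS natrD !exprS; ring.
Qed.

End Residues.

Lemma der_mulE (K : comNzRingType) (A : comAlgType K) (a : A) (D : Der A) x :
  der_mul a D x = a * D x.
Proof. by []. Qed.

(** * phi_1 and phi_2 as residue forms *)

Section Forms.
Variable K : numFieldType.
Local Notation Sring := (fpalg (presS K)).
Local Notation s := (sS K).
Local Notation w := (sS K - 1).
Local Notation ds := (dS K).

(** A derivation of S is determined by its value at s: Der(S) = S d/ds. *)
Lemma der_SE (X : Der Sring) x : X x = X s * ds x.
Proof.
elim/Sring_ind: x => [c x y ex ey | k | l].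
- by rewrite !derDZ ex ey mulrDr scalerAr.
- by rewrite (derXz _ _ (sS_unit K)) ds_s mulrA mulrC.
by rewrite exprnN (derXz _ _ (sS1_unit K)) ds_w derB der1 subr0 mulrA mulrC.
Qed.

Lemma der_S_ind (Q : Der Sring -> Prop) :
  (forall c X Y, Q X -> Q Y -> Q (c *: X + Y)) ->
  (forall k : int, Q (sder K k)) -> (forall l : nat, Q (s1der K (- l.+1%:Z))) ->
  forall X, Q X.
Proof.
move=> Ql Qs Qw X; have -> : X = der_mul (X s) ds.
  by apply: der_eq => x; rewrite der_SE.
elim/Sring_ind: (X s) => [c x y Qx Qy | k | l]; first last.
- by have := Qw l; rewrite /s1der -exprnN.
- exact: Qs.
have -> : der_mul (c *: x + y) ds = c *: der_mul x ds + der_mul y ds.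
  apply: der_eq => z; rewrite der_addE der_scaleE.
  by rewrite [LHS]mulrDl -scalerAl.
exact: Ql.
Qed.

Lemma der_S_form_ext (phi psi : Der Sring -> Der Sring -> K) :
    bilinear_for *%R *%R phi -> bilinear_for *%R *%R psi ->
    (forall X Y, phi X Y = - phi Y X) -> (forall X Y, psi X Y = - psi Y X) ->
    (forall k l, phi (sder K k) (sder K l) = psi (sder K k) (sder K l)) ->
    (forall k (l : nat), phi (sder K k) (s1der K (- l.+1%:Z)) =
                         psi (sder K k) (s1der K (- l.+1%:Z))) ->
    (forall k l : nat, phi (s1der K (- k.+1%:Z)) (s1der K (- l.+1%:Z)) =
                       psi (s1der K (- k.+1%:Z)) (s1der K (- l.+1%:Z))) ->
  forall X Y, phi X Y = psi X Y.
Proof.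
move=> [phil phir] [psil psir] phiC psiC ess esw eww.
elim/der_S_ind => [c X1 X2 e1 e2 Y | k | k].
- by have /= -> := phil Y c X1 X2; have /= -> := psil Y c X1 X2; rewrite e1 e2.
- elim/der_S_ind => [c Y1 Y2 e1 e2 | l | l]; [|exact: ess|exact: esw].
  have /= -> := phir (sder K k) c Y1 Y2.
  by have /= -> := psir (sder K k) c Y1 Y2; rewrite e1 e2.
elim/der_S_ind => [c Y1 Y2 e1 e2 | l | l]; [|by rewrite phiC psiC esw|exact: eww].
have /= -> := phir (s1der K (- k.+1%:Z)) c Y1 Y2.
by have /= -> := psir (s1der K (- k.+1%:Z)) c Y1 Y2; rewrite e1 e2.
Qed.

Definition der_form (F : {scalar Sring}) (X Y : Der Sring) : K :=
  gf_form ds F (X s) (Y s).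

Lemma der_form_bilinear F : bilinear_for *%R *%R (der_form F).
Proof.
have [gl gr] := gf_form_bilinear ds F.
split=> [Z c X Y | Z c X Y]; rewrite /der_form der_addE der_scaleE.
  exact: (gl _ c).
exact: (gr _ c).
Qed.

Section Cocycle.
Variable F : {scalar Sring}.
Hypothesis Fds : forall x, F (ds x) = 0.

Lemma der_form_skew X Y : der_form F X Y = - der_form F Y X.
Proof. exact: gf_form_skew. Qed.

Lemma der_form_cocycle : two_cocycle (der_form F).
Proof.
split; [exact: der_form_bilinear | exact: der_form_skew |] => X Y Z.
have br (U V : Der Sring) : (bracket U V : Der Sring) s =
    U s * ds (V s) - V s * ds (U s).
  by rewrite [LHS]der_bracketE der_SE [V (U s)]der_SE.
rewrite /der_form !br; exact: gf_form_cocycle.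
Qed.

End Cocycle.

Lemma sder_s k : sder K k s = s ^ k.
Proof. by rewrite der_mulE dSs mulr1. Qed.
Lemma s1der_s k : s1der K k s = w ^ k.
Proof. by rewrite der_mulE dSs mulr1. Qed.

Lemma der_form_ss F (k l : int) : der_form F (sder K k) (sder K l) =
  (k * (k - 1) * (k - 2))%:~R * F (s ^ (k + l - 3)).
Proof.
rewrite /der_form /gf_form !sder_s d3s_s -[_%:~R * _ * _]mulrA scalar_intl.
by rewrite -exprzDr ?sS_unit //; congr (_ * F (_ ^ _)); lia.
Qed.

Lemma der_form_sw F (k : int) (l : nat) :
  der_form F (sder K k) (s1der K (- l%:Z)) =
  (k * (k - 1) * (k - 2))%:~R * F (s ^ (k - 3) * w ^- l).
Proof.
by rewrite /der_form /gf_form sder_s s1der_s d3s_s -[_%:~R * _ * _]mulrA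
  scalar_intl exprnN.
Qed.

Lemma der_form_ww F (k l : nat) :
  der_form F (s1der K (- k%:Z)) (s1der K (- l%:Z)) =
  - (k * (k + 1) * (k + 2))%:R * F (w ^- (k + l + 3)).
Proof.
rewrite /der_form /gf_form !s1der_s d3s_w -[_%:~R * _ * _]mulrA scalar_intl
  exprnN.
rewrite -exprzDr ?sS1_unit // [in RHS]pmulrn -[in RHS]mulrNz.
by congr (_%:~R * F (_ ^ _)); lia.
Qed.

Lemma der_form_ws F (k : nat) (l : int) :
  der_form F (s1der K (- k%:Z)) (sder K l) =
  - (k * (k + 1) * (k + 2))%:R * F (s ^ l * w ^- (k + 3)).
Proof.
rewrite /der_form /gf_form sder_s s1der_s d3s_w -[_%:~R * _ * _]mulrA scalar_intl
  exprnN.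
rewrite [w ^ _ * _]mulrC [in RHS]pmulrn -[in RHS]mulrNz.
by congr (_%:~R * F (_ * _ ^ _)); lia.
Qed.

Lemma bin_fact3 k l :
  (k.+1 * k.+2 * k.+3 * 'C(l + k.+3, k.+3))%:R =
  (k.+1 + l.+1 + 1)`!%:R / (k`! * l`!)%:R :> K.
Proof.
have h := @bin_fact (l + k.+3) k.+3 (leq_addl _ _); rewrite addnK in h.
apply: (canRL (mulfK _)); first by rewrite pnatr_eq0 -lt0n muln_gt0 !fact_gt0.
rewrite -natrM (_ : (k.+1 + l.+1 + 1 = l + k.+3)%N); last by lia.
by rewrite -h !factS; congr _%:R; ring.
Qed.

Lemma bin_diag3 n m :
  (n.+3 * n.+2 * n.+1 * 'C(n, m) = 'C(n.+3, m.+3) * (m.+3 * m.+2 * m.+1))%N.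
Proof.
have /= h1 := mul_bin_diag n.+1 m; have /= h2 := mul_bin_diag n.+2 m.+1.
have /= h3 := mul_bin_diag n.+3 m.+2.
rewrite -mulnA h1 -mulnA (mulnCA n.+2) h2 (mulnCA n.+3) (mulnCA n.+3) h3.
by ring.
Qed.

(** Near 0 only s^n with n < 0 has a pole, and a power s^n with 0 <= n <= 2 has
    zero third derivative; this accounts for the vanishing clauses. *)
Lemma is_phi1_res0 : is_phi1 (der_form (res0 K)).
Proof.
split; first exact: der_form_bilinear.
split=> [X Y | k l | k l k0 l0 | k l l0 | k l k0 l0].
- exact/der_form_skew/res0_ds.
- rewrite der_form_ss res0_s mulrC.
  have [->|kl] := eqVneq k l.
    rewrite (_ : _ + _ - 3 == -1 = true); last by lia.
    by congr (_ * _%:~R); ring.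
  by rewrite (_ : _ + _ - 3 == -1 = false) ?mul0r //; lia.
- case: k l k0 l0 => // k [] // l _ _; rewrite der_form_sw.
  rewrite (_ : - k.+1%:Z - 3 = - k.+3.+1%:Z); last by lia.
  rewrite res0_pole !subn1 /= -[RHS]mulrA -bin_fact3 [in RHS]natrM.
  rewrite (_ : _ * _ * _ = - (k.+1 * k.+2 * k.+3)%N%:Z); last by lia.
  by rewrite mulrNz -pmulrn addn1 [in RHS]exprS; ring.
- case: l l0 => // l _; rewrite der_form_sw.
  case: k => [|[|[|k]]].
  + by rewrite !mul0r.
  + by rewrite subrr mulr0 !mul0r.
  + by rewrite subrr mulr0 !mul0r.
  by rewrite (_ : k.+3%:Z - 3 = k) ?res0_regular ?mulr0 //; lia.
by rewrite der_form_ww addn3 res0_w mulr0.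
Qed.

Lemma is_phi2_res1 : is_phi2 (der_form (res1 K)).
Proof.
split; [split=> [|X Y | k l | k l k0 l0] | split=> [k l | l l0 | k l k0 l0]].
- exact: der_form_bilinear.
- exact/der_form_skew/res1_ds.
- case: l => [|[|l]].
  + rewrite expr0n subrr mulr0 oppr0 add0r /der_form /gf_form sder_s s1der_s.
    rewrite d3s_s expr1z -[_%:~R * _ * _]mulrA scalar_intl.
    rewrite [_ * (s - 1)]mulrBr mulr1.
    by rewrite -exprzS_s raddfB /= !res1_s subrr mulr0.
  + rewrite expr1n subrr mulr0.
    have := der_form_sw (res1 K) (k%:Z + 1) 0; rewrite oppr0 => ->.
    by rewrite expr0 invr1 mulr1 res1_s mulr0.
  rewrite (_ : - l.+2%:Z + 1 = - l.+1%:Z); last by lia.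
  rewrite der_form_sw; case: k => [|[|k]].
  + by rewrite add0r subrr mulr0 !mul0r.
  + by rewrite (_ : 1%:Z + 1 - 2 = 0) // mulr0 mul0r !addn1 bin_small ?mul0r.
  rewrite (_ : k.+2%:Z + 1 - 3 = k); last by lia.
  rewrite res1_regular !addn1.
  rewrite (_ : _ * _ * _ = (k.+3 * k.+2 * k.+1)%N%:Z); last by lia.
  rewrite (_ : l.+2%:Z ^+ 3 - l.+2%:Z = (l.+3 * l.+2 * l.+1)%N%:Z).
    by rewrite -!pmulrn -!natrM bin_diag3.
  have eS m : m.+1%:Z = m%:Z + 1 by lia.
  by rewrite !PoszM !eS; ring.
- case: k l k0 l0 => // k [] // l _ _; rewrite der_form_ws.
  rewrite addn3 res1_pole !subn1 /= -[RHS]mulrA -bin_fact3 [in RHS]natrM.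
  rewrite (_ : k.+1 * _ * _ = k.+1 * k.+2 * k.+3)%N; last by lia.
  by rewrite addn1 !exprS; ring.
- by rewrite der_form_ss res1_s mulr0.
- by rewrite der_form_sw !mul0r.
by case: k k0 => // k _; rewrite der_form_ww addn3 res1_w addSn /= mulr0.
Qed.

Lemma is_phi1_uniq phi psi : is_phi1 phi -> is_phi1 psi ->
  forall X Y : Der Sring, phi X Y = psi X Y.
Proof.
move=> [phib [phiC phi_ss phi_ps phi_rs phi_ww]].
move=> [psib [psiC psi_ss psi_ps psi_rs psi_ww]].
apply: (der_S_form_ext phib psib phiC psiC) => [k l | k l | k l].
- rewrite (_ : k = (k - 1) + 1); last by lia.
  by rewrite (_ : l = - (1 - l) + 1) ?phi_ss ?psi_ss //; lia.
- case: k => k; first by rewrite phi_rs ?psi_rs.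
  by rewrite NegzE phi_ps ?psi_ps.
by rewrite phi_ww ?psi_ww.
Qed.

Lemma is_phi2_uniq phi psi : is_phi2 phi -> is_phi2 psi ->
  forall X Y : Der Sring, phi X Y = psi X Y.
Proof.
move=> [[phib phiC phi_rs phi_ps] [phi_ss phi_0s phi_ww]].
move=> [[psib psiC psi_rs psi_ps] [psi_ss psi_0s psi_ww]].
apply: (der_S_form_ext phib psib phiC psiC) => [k l | k l | k l].
- by rewrite phi_ss psi_ss.
- case: k => [[|k]|k]; first by rewrite phi_0s ?psi_0s.
    rewrite (_ : k.+1%:Z = k%:Z + 1); last by lia.
    by rewrite (_ : - l.+1%:Z = - l.+2%:Z + 1) ?phi_rs ?psi_rs //; lia.
  by rewrite NegzE phiC psiC phi_ps ?psi_ps.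
by rewrite phi_ww ?psi_ww.
Qed.

Lemma phi1E X Y : phi1 K X Y = der_form (res0 K) X Y.
Proof.
rewrite /phi1; case: xgetP => [phi _ phiP|no]; last by case: (no _ is_phi1_res0).
exact: is_phi1_uniq phiP is_phi1_res0 X Y.
Qed.

Lemma phi2E X Y : phi2 K X Y = der_form (res1 K) X Y.
Proof.
rewrite /phi2; case: xgetP => [phi _ phiP|no]; last by case: (no _ is_phi2_res1).
exact: is_phi2_uniq phiP is_phi2_res1 X Y.
Qed.

End Forms.

(** * Transport of derivations along an isomorphism *)

Section DerConj.
Variables (K : comNzRingType) (A B : comAlgType K).
Variables (f : {lrmorphism A -> B}) (g : {lrmorphism B -> A}).
Hypotheses (gK : cancel g f) (fK : cancel f g).
Local Notation Phi := (der_conj gK).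

Lemma der_conj_linear : linear Phi.
Proof. by move=> c X Y; apply: der_eq => x; exact: linearP. Qed.

Lemma der_conj_bracket (X Y : Der A) :
  der_conj gK (bracket X Y) = bracket (der_conj gK X) (der_conj gK Y).
Proof.
apply: der_eq => x.
have -> : der_conj gK (bracket X Y) x = f (X (Y (g x)) - Y (X (g x))) by [].
have -> : (bracket (der_conj gK X) (der_conj gK Y) : Der B) x =
  f (X (g (f (Y (g x))))) - f (Y (g (f (X (g x))))) by [].
by rewrite !fK raddfB.
Qed.

End DerConj.

(** * Gelfand-Fuchs forms under an Euler derivation *)

(** The Gelfand-Fuchs form in the logarithmic coordinate: with theta = x d/dx, both
    sides are 3 x^2 a'' + x^3 a'''. *)
Lemma euler_cube (K : comNzRingType) (A : comAlgType K) (d : Der A) x a :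
  d x = 1 ->
  let theta y := x * d y in
  theta (theta (theta a)) - theta a = x ^+ 2 * d (d (d (a * x))).
Proof. by move=> dx /=; rewrite !(derM, derD, dx, der1, der0); ring. Qed.

Section EulerForm.
Variables (K : comNzRingType) (A B : comUnitAlgType K).
Variables (f : {lrmorphism A -> B}) (g : {lrmorphism B -> A}).
Hypotheses (gK : cancel g f) (fK : cancel f g).
Variables (D : Der A) (d : Der B) (s : B).
Hypotheses (ds : d s = 1) (sU : s \is a GRing.unit).
Hypothesis (derE : forall (X : Der B) x, X x = X s * d x).
Hypothesis (PhiD : f (D (g s)) = s).

Lemma euler_conj a : f (D a) = s * d (f a).
Proof. by have := derE (der_conj gK D) (f a); rewrite /= PhiD fK. Qed.

Variable F : {scalar B}.
Hypothesis Fd : forall x, F (d x) = 0.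

(** Pairing with the invariant differential ds / s. *)
Definition dlog_fun (a : A) : K := F (s^-1 * f a).

Lemma dlog_fun_scalar : scalar dlog_fun.
Proof. by move=> c a b; rewrite /dlog_fun linearP /= mulrDr -scalerAr linearP. Qed.
HB.instance Definition _ := GRing.isLinear.Build K A K *%R dlog_fun dlog_fun_scalar.

Lemma dlog_fun_der a : dlog_fun (D a) = 0.
Proof. by rewrite /dlog_fun euler_conj mulKr. Qed.

Lemma gf_form_conj a b :
  gf_form d F (der_conj gK (der_mul a D) s) (der_conj gK (der_mul b D) s) =
  dlog_fun ((D (D (D a)) - D a) * b).
Proof.
rewrite /gf_form /dlog_fun /= ![f (_ * D _)]rmorphM /= PhiD; congr (F _).
rewrite rmorphM rmorphB /= !euler_conj.
have /= -> := euler_cube (f a) ds; set x := d _.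
have -> : s^-1 * (s ^+ 2 * x * f b) = s^-1 * s * (x * (f b * s)) by ring.
by rewrite mulVr // mul1r.
Qed.

End EulerForm.

(** * The form in coordinates t, u *)

Section Coef.
Variable K : numFieldType.

Lemma invfact_rec (n : int) :
  invfact K n = (n + 1)%:~R * invfact K (n + 1).
Proof.
case: n => [n|[|n]]; last first.
- by rewrite (_ : Negz n.+1 + 1 = Negz n) ?mulr0 //; lia.
- by rewrite (_ : Negz 0 + 1 = 0) ?mul0r //; lia.
rewrite (_ : n%:Z + 1 = n.+1); last by lia.
rewrite /invfact factS natrM invfM mulrA -pmulrn mulfV ?mul1r //.
by rewrite pnatr_eq0.
Qed.

(** The solution of the recursion [rho_t_rec] with value 1 at n = 0.  At n = -1 the
    recursion forces the value 0, and hence 0 for all n < 0: this is the convention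
    1 / n! = 0. *)
Definition rho_coef (n : int) : K :=
  (-1) ^ n * 2 ^ n * (dblfact K (2 * n - 1) * invfact K n).

Lemma rho_coef_rec (n : int) :
  (n + 1)%:~R * rho_coef (n + 1) = - ((4 * n + 2)%:~R * rho_coef n).
Proof.
rewrite /rho_coef (_ : 2 * (n + 1) - 1 = 2 * n + 1); last by lia.
rewrite (invfact_rec n) dblfact_rec.
have u1 : (-1 : K) \is a GRing.unit by rewrite unitrN1.
have u2 : (2 : K) \is a GRing.unit by rewrite unitfE pnatr_eq0.
rewrite !exprzDr // !expr1z.
by rewrite !(intrD, intrM); ring.
Qed.

End Coef.

Section Values.
Variables (K : numFieldType) (A : comUnitAlgType K) (D : Der A) (t u : A).
Hypotheses (tU : t \is a GRing.unit) (uu : u ^+ 2 = t ^+ 2 + 4 * t).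
Hypotheses (Dt : D t = u) (Du : D u = t + 2).

Lemma D_t (n : int) : D (t ^ n) = n%:~R * (t ^ (n - 1) * u).
Proof. by rewrite (derXz _ _ tU) Dt. Qed.

Lemma tzS (n : int) : t ^ (n + 1) = t ^ n * t.
Proof. by rewrite exprzDr ?tU // expr1z. Qed.

Lemma t_u_u (n : int) : t ^ n * u * u = t ^ (n + 2) + 4 * t ^ (n + 1).
Proof.
have -> : n + 2 = n + 1 + 1 by lia.
by rewrite -mulrA -expr2 uu !tzS; ring.
Qed.

Lemma D_tu (n : int) :
  D (t ^ n * u) = (n + 1)%:~R * t ^ (n + 1) + (4 * n + 2)%:~R * t ^ n.
Proof.
rewrite derM D_t Du -mulrA t_u_u.
have -> : n - 1 + 2 = n + 1 by lia.
rewrite subrK tzS.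
by rewrite !(intrD, intrM); ring.
Qed.

Lemma t_mulz (n m : int) : t ^ n * t ^ m = t ^ (n + m).
Proof. by rewrite exprzDr ?tU. Qed.

(** D^2 preserves the span of the t^n, so D^3 - D sends t^k to u times a Laurent
    polynomial, whereas it sends t^k u to a Laurent polynomial. *)
Lemma D3_t (k : int) : D (D (D (t ^ k))) - D (t ^ k) =
  (k ^+ 3 - k)%:~R * (t ^ (k - 1) * u)
  + (k * (k - 1) * (4 * k - 2))%:~R * (t ^ (k - 2) * u).
Proof.
rewrite D_t der_intl D_tu (_ : k - 1 + 1 = k); last by lia.
rewrite der_intl derD !der_intl !D_t (_ : k - 1 - 1 = k - 2); last by lia.
by rewrite !(intrB, intrD, intrM, rmorphXn) /=; ring.
Qed.

Lemma D3_tu (k : int) : D (D (D (t ^ k * u))) - D (t ^ k * u) =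
  (k * (k + 1) * (k + 2))%:~R * t ^ (k + 1)
  + (4 * k * (2 * k + 1) * (k + 1))%:~R * t ^ k
  + (4 * k * (2 * k - 1) * (2 * k + 1))%:~R * t ^ (k - 1).
Proof.
rewrite D_tu !(derD, der_intl) !D_t !(derD, der_intl) !D_tu.
rewrite !addrK.
by rewrite !(intrB, intrD, intrM); ring.
Qed.

Variable rho : {scalar A}.
Hypothesis rho_D : forall a, rho (D a) = 0.

(** t^n u is D(t^(n+1)) / (n+1) unless n = -1. *)
Lemma rho_tu (n : int) : rho (t ^ n * u) = (n == -1)%:R * rho (t ^ (-1) * u).
Proof.
have [->|nN1] := eqVneq n (-1); first by rewrite mul1r.
have := rho_D (t ^ (n + 1)); rewrite D_t scalar_intl addrK /= => /eqP.
by rewrite mulf_eq0 intr_eq0 addr_eq0 (negPf nN1) mul0r => /eqP.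
Qed.

(** Apply the functional to D(t^n u). *)
Lemma rho_t_rec (n : int) :
  (n + 1)%:~R * rho (t ^ (n + 1)) = - ((4 * n + 2)%:~R * rho (t ^ n)).
Proof.
have := rho_D (t ^ n * u); rewrite D_tu raddfD /= !scalar_intl /=.
by move/eqP; rewrite addr_eq0 => /eqP.
Qed.

Lemma rho_t (n : int) : rho (t ^ n) = rho 1 * rho_coef K n.
Proof.
elim/int_rec: n => [|n IHn|n IHn].
- rewrite expr0z /rho_coef !expr0z mulr0 sub0r dblfactN1.
  have -> : invfact K 0 = 1 by rewrite /= invr1.
  by rewrite !mulr1.
- have n0 : (n%:Z + 1)%:~R != 0 :> K by rewrite intr_eq0; lia.
  rewrite -addn1 PoszD; apply: (mulfI n0).
  by rewrite rho_t_rec IHn [in RHS]mulrCA rho_coef_rec; ring.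
have n0 : (4 * - n.+1%:Z + 2)%:~R != 0 :> K by rewrite intr_eq0; lia.
apply: (mulfI n0); apply: oppr_inj.
rewrite -rho_t_rec mulrCA -mulrN -rho_coef_rec.
rewrite (_ : - n.+1%:Z + 1 = - n%:Z) ?IHn; last by lia.
by ring.
Qed.


(** The brackets of t^k D and t^-k D are all proportional, whereas the form grows
    like k^3; hence the form is not a coboundary. *)
Lemma bracket_powers (k : int) :
  bracket (der_mul (t ^ k) D) (der_mul (t ^ (- k)) D) =
  (- 2 * k)%:~R *: der_mul (t ^ (-1) * u) D :> Der A.
Proof.
apply: der_eq => x; rewrite der_scaleE der_mulE.
have -> : (bracket (der_mul (t ^ k) D) (der_mul (t ^ (- k)) D) : Der A) x =
    t ^ k * D (t ^ (- k) * D x) - t ^ (- k) * D (t ^ k * D x) by [].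
have e (i j : int) : t ^ i * D (t ^ j * D x) =
    j%:~R * (t ^ (i + j - 1) * u * D x) + t ^ (i + j) * D (D x).
  by rewrite derM D_t -addrA -!t_mulz; ring.
rewrite !e subrr addNr sub0r scaler_int -mulrzl !(intrM, mulrNz).
by ring.
Qed.

Definition euler_form (a b : A) : K := rho ((D (D (D a)) - D a) * b).

Lemma euler_form_tt (k l : int) : euler_form (t ^ k) (t ^ l) =
  - rho (t ^ (-1) * u) *
  (2 * (l ^+ 2 - l) * (2 * l - 1) * (k + l == 1)%:R
   + (l ^+ 3 - l) * (k + l == 0)%:R)%:~R.
Proof.
have mulE c n : c%:~R * (t ^ n * u) * t ^ l = c%:~R * (t ^ (n + l) * u) :> A.
  by rewrite -t_mulz; ring.
rewrite /euler_form D3_t mulrDl !mulE raddfD /= !scalar_intl /=.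
rewrite !(rho_tu (_ + _)).
rewrite (_ : (k - 1 + l == -1) = (k + l == 0)); last by lia.
rewrite (_ : (k - 2 + l == -1) = (k + l == 1)); last by lia.
have [kl1|_] := eqVneq (k + l) 1.
  rewrite kl1 (_ : k = 1 - l) /=; last by lia.
  by rewrite !(intrD, intrM, intrB, rmorphXn) /=; ring.
have [kl0|_] := eqVneq (k + l) 0; last by rewrite !(mulr0, mul0r, addr0).
rewrite (_ : k = - l) /=; last by lia.
by rewrite !(intrD, intrM, intrB, rmorphXn) /=; ring.
Qed.

Lemma euler_form_uu (k l : int) : euler_form (t ^ k * u) (t ^ l * u) =
  - rho (t ^ (-1) * u) *
  (l * (l + 1) * (l + 2) * (k + l == -2)%:R
   + 4 * l * (2 * l + 1) * (l + 1) * (k + l == -1)%:R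
   + 4 * l * (2 * l - 1) * (2 * l + 1) * (k + l == 0)%:R)%:~R.
Proof.
have mulE c n : c%:~R * t ^ n * (t ^ l * u) = c%:~R * (t ^ (n + l) * u) :> A.
  by rewrite -t_mulz; ring.
rewrite /euler_form D3_tu 2!mulrDl !mulE.
rewrite 2!raddfD /= !scalar_intl /= !(rho_tu (_ + _)).
rewrite (_ : (k + 1 + l == -1) = (k + l == -2)); last by lia.
rewrite (_ : (k - 1 + l == -1) = (k + l == 0)); last by lia.
have [kl|_] := eqVneq (k + l) (-2).
  rewrite kl (_ : k = - 2 - l) /=; last by lia.
  by rewrite !(intrD, intrM, intrB, rmorphXn) /=; ring.
have [kl|_] := eqVneq (k + l) (-1).
  rewrite kl (_ : k = - 1 - l) /=; last by lia.
  by rewrite !(intrD, intrM, intrB, rmorphXn) /=; ring.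
have [kl|_] := eqVneq (k + l) 0; last by rewrite !(mulr0, mul0r, addr0).
rewrite (_ : k = - l) /=; last by lia.
by rewrite !(intrD, intrM, intrB, rmorphXn) /=; ring.
Qed.

(** With c the factor (-2)^n (2n-3)!! / (n+1)!, n = k + l, the three values of the
    functional that occur are polynomial multiples of c, and k(k-1) times a
    combination of them collapses to 6 (k-1) k l c. *)
Lemma euler_form_tu (k l : int) : euler_form (t ^ k) (t ^ l * u) =
  rho 1 * (6 * (-1) ^ (k + l) * 2 ^ (k + l) * ((k - 1) * k * l)%:~R
          * (dblfact K (2 * k + 2 * l - 3) * invfact K (k + l + 1))).
Proof.
have mulE c n : c%:~R * (t ^ n * u) * (t ^ l * u) =
    c%:~R * (t ^ (n + l + 2) + 4%:~R * t ^ (n + l + 1)) :> A.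
  by rewrite -t_u_u -t_mulz; ring.
rewrite /euler_form D3_t mulrDl !mulE.
have rhoE c x y : rho (c%:~R * (x + 4%:~R * y)) =
    c%:~R * (rho x + 4%:~R * rho y) by rewrite scalar_intl raddfD /= scalar_intl.
rewrite raddfD /= !rhoE !rho_t.
(* All exponents are counted from the smallest one, which avoids division. *)
pose m := k + l - 1.
have -> : k - 1 + l + 2 = m + 1 + 1 by rewrite /m; lia.
have -> : k - 1 + l + 1 = m + 1 by rewrite /m; lia.
have -> : k - 2 + l + 2 = m + 1 by rewrite /m; lia.
have -> : k - 2 + l + 1 = m by rewrite /m; lia.
have -> : 2 * k + 2 * l - 3 = 2 * m - 1 by rewrite /m; lia.
have -> : k + l = m + 1 by rewrite /m; lia.
have -> : l = m + 1 - k by rewrite /m; lia.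
clearbody m; rewrite /rho_coef.
have -> : 2 * (m + 1 + 1) - 1 = 2 * (m + 1) + 1 by lia.
rewrite dblfact_rec.
have -> : 2 * (m + 1) - 1 = 2 * m + 1 by lia.
rewrite dblfact_rec (invfact_rec K m) (invfact_rec K (m + 1)).
have u1 : (-1 : K) \is a GRing.unit by rewrite unitrN1.
have u2 : (2 : K) \is a GRing.unit by rewrite unitfE pnatr_eq0.
rewrite !exprzDr // !expr1z !(intrD, intrM, intrB, rmorphXn) /=.
ring.
Qed.

End Values.

(** * Values of phibar_1 and phibar_2 *)

(** The partial fraction decomposition (s + 1) / (s (s - 1)) = 2 / (s - 1) - 1 / s
    of f(t^-1 u) / s, for a = s^-1 and b = (s - 1)^-1. *)
Lemma inverse_pair_split (A : comNzRingType) (s a b : A) :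
  a * s = 1 -> b * (s - 1) = 1 -> a * (b ^+ 2 * s * (s - a)) = 2 * b - a.
Proof.
move=> e1 e2.
have ab : a * b = b - a.
  have -> : a * b = b * (a * s) - a * (b * (s - 1)) by ring.
  by rewrite e1 e2 !mulr1.
have -> : a * (b ^+ 2 * s * (s - a)) = a * s * (b * (b * (s - 1) + b - a * b)).
  by ring.
rewrite e1 e2 ab mul1r (_ : b * _ = b + a * b); last by ring.
by rewrite ab; ring.
Qed.

Section Transport.
Variable K : numFieldType.
Local Notation Rring := (fpalg (presR K)).
Local Notation Sring := (fpalg (presS K)).
Local Notation s := (sS K).
Local Notation w := (sS K - 1).
Local Notation ds := (dS K).
Local Notation t := (tR K).
Local Notation u := (uR K).
Local Notation D := (derD_R K).
Local Notation f := (isoF K).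
Local Notation g := (isoG K).
Local Notation Phi := (@PhiF K).

Lemma PhiF_linear : linear Phi.
Proof. exact: der_conj_linear. Qed.

Lemma PhiF_bracket (X Y : Der Rring) :
  Phi (bracket X Y) = bracket (Phi X) (Phi Y).
Proof. by rewrite /PhiF der_conj_bracket //; exact: isoFK. Qed.

Lemma two_cocycle_PhiF phi :
  two_cocycle phi -> two_cocycle (fun X Y => phi (Phi X) (Phi Y)).
Proof.
move=> [[phil phir] phiC phiJ]; split=> [|X Y|X Y Z].
- split=> [Z c X Y|Z c X Y] /=; rewrite (PhiF_linear c X Y).
    exact: (phil _ c).
  exact: (phir _ c).
- exact: phiC.
by rewrite !PhiF_bracket phiJ.
Qed.

Lemma der_R_half : D 2^-1 = 0.
Proof. by rewrite (derV _ (unit2 Rring)) der_natr mulr0 oppr0. Qed.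

(** f carries D to the Euler derivation s d/ds. *)
Lemma PhiF_D_s : Phi D s = s.
Proof.
rewrite PhiFE -[RHS](isoGK s) isoGs; congr (f _).
rewrite derM der_R_half mulr0 addr0 derD derD der_natr addr0 derD_Rt derD_Ru.
by congr (_ * _); rewrite addrC.
Qed.

Lemma PhiF_D_gs : f (D (g s)) = s.
Proof. by rewrite -PhiFE PhiF_D_s. Qed.

Section Rho.
Variable F : {scalar Sring}.
Hypothesis Fds : forall x, F (ds x) = 0.

Definition dlog_funR : {scalar Rring} := dlog_fun f s F.

Lemma dlog_funR_D a : dlog_funR (D a) = 0.
Proof.
exact: (dlog_fun_der (@isoGK K) (@isoFK K) (sS_unit K) (@der_SE K) PhiF_D_gs Fds).
Qed.

Lemma der_form_mulD a b :
  der_form F (Phi (der_mul a D)) (Phi (der_mul b D)) = euler_form D dlog_funR a b.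
Proof.
exact: (gf_form_conj (@isoGK K) (@isoFK K) (dSs K) (sS_unit K) (@der_SE K) PhiF_D_gs).
Qed.

Lemma dlog_funR1 : dlog_funR 1 = F (s ^ (-1)).
Proof. by rewrite /dlog_funR /= /dlog_fun rmorph1 mulr1. Qed.

Lemma isoF_tVu : s^-1 * f (t ^ (-1) * u) = 2 * w^-1 - s^-1.
Proof.
rewrite rmorphM /= (rmorphV _ (tR_unit K)) /= isoFt isoFu.
have sU := sS_unit K; have wU := sS1_unit K.
rewrite invrM ?unitrV ?unitrX // invrK -exprVn.
exact: inverse_pair_split (mulVr sU) (mulVr wU).
Qed.

Lemma dlog_funR_tVu : dlog_funR (t ^ (-1) * u) = 2 * F (w ^- 1) - F (s ^ (-1)).
Proof.
rewrite /dlog_funR /= /dlog_fun isoF_tVu expr1 raddfB /=.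
by rewrite !mulr_natl raddfMn.
Qed.

End Rho.

Lemma phibar1E a b :
  phibar1 K (der_mul a D) (der_mul b D) = euler_form D (dlog_funR (res0 K)) a b.
Proof. by rewrite /phibar1 phi1E der_form_mulD. Qed.

Lemma phibar2E a b :
  phibar2 K (der_mul a D) (der_mul b D) = euler_form D (dlog_funR (res1 K)) a b.
Proof. by rewrite /phibar2 phi2E der_form_mulD. Qed.

Lemma dlog_funR_res0_tVu : dlog_funR (res0 K) (t ^ (-1) * u) = -1.
Proof. by rewrite dlog_funR_tVu res0_w res0_s mulr0 sub0r. Qed.
Lemma dlog_funR_res1_tVu : dlog_funR (res1 K) (t ^ (-1) * u) = 2.
Proof. by rewrite dlog_funR_tVu res1_w res1_s mulr1 subr0. Qed.

Lemma phibar1_ee (k l : int) : phibar1 K (eR K k) (eR K l) =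
  (2 * (l ^+ 2 - l) * (2 * l - 1) * (k + l == 1)%:R
   + (l ^+ 3 - l) * (k + l == 0)%:R)%:~R.
Proof.
rewrite phibar1E (euler_form_tt (tR_unit K) (uR_sqr K) (derD_Rt K) (derD_Ru K)).
  by rewrite dlog_funR_res0_tVu opprK mul1r.
exact/dlog_funR_D/res0_ds.
Qed.

Lemma phibar1_ed (k l : int) : phibar1 K (eR K k) (dR K l) =
  6 * (-1) ^ (k + l) * 2 ^ (k + l) * ((k - 1) * k * l)%:~R
    * (dblfact K (2 * k + 2 * l - 3) * invfact K (k + l + 1)).
Proof.
rewrite phibar1E (euler_form_tu (tR_unit K) (uR_sqr K) (derD_Rt K) (derD_Ru K)).
  by rewrite dlog_funR1 res0_s mul1r.
exact/dlog_funR_D/res0_ds.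
Qed.

Lemma phibar1_dd (k l : int) : phibar1 K (dR K k) (dR K l) =
  (l * (l + 1) * (l + 2) * (k + l == -2)%:R
   + 4 * l * (2 * l + 1) * (l + 1) * (k + l == -1)%:R
   + 4 * l * (2 * l - 1) * (2 * l + 1) * (k + l == 0)%:R)%:~R.
Proof.
rewrite phibar1E (euler_form_uu (tR_unit K) (uR_sqr K) (derD_Rt K) (derD_Ru K)).
  by rewrite dlog_funR_res0_tVu opprK mul1r.
exact/dlog_funR_D/res0_ds.
Qed.

Lemma phibar2_ee k l :
  phibar2 K (eR K k) (eR K l) = - 2 * phibar1 K (eR K k) (eR K l).
Proof.
rewrite phibar1_ee phibar2E.
rewrite (euler_form_tt (tR_unit K) (uR_sqr K) (derD_Rt K) (derD_Ru K)).
  by rewrite dlog_funR_res1_tVu.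
exact/dlog_funR_D/res1_ds.
Qed.

Lemma phibar2_dd k l :
  phibar2 K (dR K k) (dR K l) = - 2 * phibar1 K (dR K k) (dR K l).
Proof.
rewrite phibar1_dd phibar2E.
rewrite (euler_form_uu (tR_unit K) (uR_sqr K) (derD_Rt K) (derD_Ru K)).
  by rewrite dlog_funR_res1_tVu.
exact/dlog_funR_D/res1_ds.
Qed.

Lemma phibar2_ed k l : phibar2 K (eR K k) (dR K l) = 0.
Proof.
rewrite phibar2E (euler_form_tu (tR_unit K) (uR_sqr K) (derD_Rt K) (derD_Ru K)).
  by rewrite dlog_funR1 res1_s mul0r.
exact/dlog_funR_D/res1_ds.
Qed.

Lemma phibar1_cocycle : two_cocycle (phibar1 K).
Proof.
have -> : phibar1 K = fun X Y => der_form (res0 K) (Phi X) (Phi Y).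
  by apply/funext => X; apply/funext => Y; exact: phi1E.
exact/two_cocycle_PhiF/der_form_cocycle/res0_ds.
Qed.

Lemma phibar2_cocycle : two_cocycle (phibar2 K).
Proof.
have -> : phibar2 K = fun X Y => der_form (res1 K) (Phi X) (Phi Y).
  by apply/funext => X; apply/funext => Y; exact: phi2E.
exact/two_cocycle_PhiF/der_form_cocycle/res1_ds.
Qed.

(** The case k = 1 forces h (d_(-1)) = 0, and the case k = 2 then fails. *)
Lemma not_coboundary (phi : Der Rring -> Der Rring -> K) (c : K) : c != 0 ->
    (forall k : int, phi (eR K k) (eR K (- k)) = c * (k ^+ 3 - k)%:~R) ->
  ~ two_coboundary phi.
Proof.
move=> c0 phiE [h hE].
have hb (k : int) : (- 2 * k)%:~R * h (dR K (-1)) = c * (k ^+ 3 - k)%:~R.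
  rewrite -phiE hE.
  have := bracket_powers (tR_unit K) (derD_Rt K) k.
  by move=> /(congr1 h); rewrite linearZ => ->.
have /eqP := hb 1; rewrite expr1n subrr mulr0 mulf_eq0 intr_eq0 /= => /eqP hd.
have /eqP := hb 2; rewrite hd mulr0 eq_sym mulf_eq0 (negPf c0) intr_eq0.
by [].
Qed.

Lemma phibar1_ee_opp (k : int) :
  phibar1 K (eR K k) (eR K (- k)) = -1 * (k ^+ 3 - k)%:~R.
Proof.
rewrite phibar1_ee subrr mulr0 add0r mulr1 mulN1r -mulrNz.
by congr _%:~R; ring.
Qed.

Lemma phibar1_not_coboundary : ~ two_coboundary (phibar1 K).
Proof.
by apply: (not_coboundary (c := -1)) phibar1_ee_opp; rewrite oppr_eq0 oner_eq0.
Qed.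

Lemma phibar2_not_coboundary : ~ two_coboundary (phibar2 K).
Proof.
apply: (not_coboundary (c := 2)) => [|k]; first by rewrite pnatr_eq0.
by rewrite phibar2_ee phibar1_ee_opp mulrA mulrN1 opprK.
Qed.

End Transport.

Theorem theorem2p6 (R : realType) :
  let C : numFieldType := R[i] in
  let e := eR C in
  let d := dR C in
  let delta (i j : int) : int := (i == j)%:R in
  [/\ two_cocycle (phibar1 C), ~ two_coboundary (phibar1 C),
      two_cocycle (phibar2 C) & ~ two_coboundary (phibar2 C)] /\
  [/\ forall k l : int, phibar1 C (e k) (e l) =
        (2 * (l ^+ 2 - l) * (2 * l - 1) * delta (k + l) 1
         + (l ^+ 3 - l) * delta (k + l) 0)%:~R,
      forall k l : int, phibar1 C (e k) (d l) =
        6 * (-1) ^ (k + l) * 2 ^ (k + l) * ((k - 1) * k * l)%:~R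
          * (dblfact C (2 * k + 2 * l - 3) * invfact C (k + l + 1)),
      forall k l : int, phibar1 C (d l) (e k) = - phibar1 C (e k) (d l)
    & forall k l : int, phibar1 C (d k) (d l) =
        (l * (l + 1) * (l + 2) * delta (k + l) (-2)
         + 4 * l * (2 * l + 1) * (l + 1) * delta (k + l) (-1)
         + 4 * l * (2 * l - 1) * (2 * l + 1) * delta (k + l) 0)%:~R] /\
  [/\ forall k l : int, phibar2 C (e k) (e l) =
        (- 2 * (l ^+ 3 - l) * delta (k + l) 0
         - 4 * l * (l - 1) * (2 * l - 1) * delta (k + l) 1)%:~R,
      forall k l : int, phibar2 C (e k) (d l) = - phibar2 C (d l) (e k)
        /\ phibar2 C (e k) (d l) = 0
    & forall k l : int, phibar2 C (d k) (d l) =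
        (- 2 * l * (l + 1) * (l + 2) * delta (k + l) (-2)
         - 8 * l * (l + 1) * (2 * l + 1) * delta (k + l) (-1)
         - 8 * l * (2 * l - 1) * (2 * l + 1) * delta (k + l) 0)%:~R] /\
  (forall k l : int,
      phibar2 C (d k) (d l) = - 2 * phibar1 C (d k) (d l) /\
      phibar2 C (e k) (e l) = - 2 * phibar1 C (e k) (e l)).
Proof.
move=> C e d delta; split.
  by split; [exact: phibar1_cocycle | exact: phibar1_not_coboundary
            |exact: phibar2_cocycle | exact: phibar2_not_coboundary].
split.
  split=> k l; [exact: phibar1_ee | exact: phibar1_ed | | exact: phibar1_dd].
  by have [_ skew _] := phibar1_cocycle C; exact: skew.
split; last by move=> k l; split; [exact: phibar2_dd | exact: phibar2_ee].
split=> k l.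
- rewrite phibar2_ee phibar1_ee /delta.
  by rewrite !(intrD, intrM, intrB, rmorphXn) /=; ring.
- split; last exact: phibar2_ed.
  by have [_ skew _] := phibar2_cocycle C; exact: skew.
rewrite phibar2_dd phibar1_dd /delta.
by rewrite !(intrD, intrM, intrB, rmorphXn) /=; ring.
Qed.
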